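(* For fixed real $s>0$ and integer $r\ge1$, $$\limsup_{n\to\infty}\left(\frac{b_{s,r,n}}{2^n}\right)^{1/n}=\frac12 .$$ If $s\ge2$, then also $$\limsup_{n\to\infty}\left(\frac{c_{s,r,n}}{3^n}\right)^{1/n}=\frac13 .$$
   Context: For real $s>0$, $F_s$ is the analytic function on $\operatorname{Re}t>-1$ given by $$F_s(t)=\frac1{\Gamma(s)}\int_0^1\frac{(-\log x)^{s-1}}{1+tx^2}\,dx,$$ which is the analytic extension of $\sum_{k=0}^\infty\frac{(-1)^kt^k}{(2k+1)^s}$, $|t|<1$. For $|w|<1$ and $|u|<1$ put $H_s(w)=F_s\!\left(\frac{w}{1-w}\right)$ and $A_s(u)=F_s\!\left(\frac{2u}{1-u}\right)$; these functions are analytic and do not vanish in the unit disk. The numbers $b_{s,r,n}$ and $c_{s,r,n}$ are the Taylor coefficients in $$H_s(w)^{-r}=\sum_{n=0}^\infty b_{s,r,n}w^n,\qquad A_s(u)^{-r}=\sum_{n=0}^\infty c_{s,r,n}u^n .$$ The $b_{s,r,n}$ are positive for $s>0$, and the $c_{s,r,n}$ are positive for $s\ge2$. *)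

(* Defs.v *)
From HB Require Import structures.
From mathcomp Require Import all_boot all_order all_algebra.
From mathcomp Require Import all_classical all_reals all_analysis.
From mathcomp Require Import complex.

Set Implicit Arguments.
Unset Strict Implicit.
Unset Printing Implicit Defensive.

Import Order.TTheory GRing.Theory Num.Theory.
Import numFieldNormedType.Exports.

Local Open Scope classical_set_scope.
Local Open Scope ring_scope.
Local Open Scope complex_scope.

Section definitions.
Context {R : realType}.
Local Notation mu := (@lebesgue_measure R).

Definition Gamma (s : R) : R :=
  \int[mu]_(x in `]0, +oo[) (x `^ (s - 1) * expR (- x)).

Definition Cintegral (D : set R) (f : R -> R[i]) : R[i] :=
  (\int[mu]_(x in D) complex.Re (f x)) +i* (\int[mu]_(x in D) complex.Im (f x)).

(* Meaningful for [0 < s] and [-1 < Re t]. *)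
Definition Fs (s : R) (t : R[i]) : R[i] :=
  (Gamma s)^-1%:C *
  Cintegral `]0, 1[
    (fun x => ((- ln x) `^ (s - 1))%:C / (1 + t * (x ^+ 2)%:C)).

Definition Hs (s : R) (w : R[i]) : R[i] := Fs s (w / (1 - w)).

Definition As (s : R) (u : R[i]) : R[i] := Fs s (2 * u / (1 - u)).

(* [R[i]^o] selects the structure of normed space of [R[i]] over itself, so
   that the derivatives are complex derivatives. *)
Definition taylor_coef (f : R[i]^o -> R[i]^o) (n : nat) : R[i] :=
  (f^`(n))%classic 0 / n`!%:R.

(* [Hs s] and [As s] commute with complex conjugation, so that the Taylor
   coefficients at 0 of their powers are real: taking real parts only moves
   them from [R[i]] to [R]. *)
Definition bcoef (s : R) (r n : nat) : R :=
  complex.Re (taylor_coef (fun w => Hs s w ^- r) n).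

Definition ccoef (s : R) (r n : nat) : R :=
  complex.Re (taylor_coef (fun u => As s u ^- r) n).

End definitions.

(* Main.v *)
Require Import Defs.
From HB Require Import structures.
From mathcomp Require Import all_boot all_order all_algebra.
From mathcomp Require Import all_classical all_reals all_analysis measurable_realfun.
From mathcomp Require Import complex ring lra.

Import Order.TTheory GRing.Theory Num.Theory.
Import numFieldNormedType.Exports.
Local Open Scope classical_set_scope.
Local Open Scope ring_scope.
Import ComplexField.Normc.

(** Put y = 1 - k x^2, with k = 1 for [Hs] and k = 2 for [As].  Substituting
    t = k w / (1 - w) in the integral that defines [Fs s t] replaces the kernel
    1 / (1 + t x^2) by
      (1 - w) / (1 - w y) = 1 - sum_n (1 - y) y^n w^(n+1),
    so that, for small w,
      Fs s (k w / (1 - w)) = K (1 - sum_n q_n w^(n+1)),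
    where K > 0 and q_n is, up to normalization, the integral of
    (1 - y) y^n against the weight (- ln x)^(s-1) on ]0, 1[ ([expansion_Fs],
    [gap]).  The q_n telescope, hence their partial sums are at most 1
    ([sum_gap_le1]) as soon as they are nonnegative.

    Nonnegativity of q_n is clear when n is even, and also when k = 1, since then
    y >= 0.  For k = 2 and n odd it comes from the reflection
    x |-> sqrt (1 - x^2), which changes y into - y: the two halves of the
    integral combine into one whose sign is that of
    x (- ln x)^(s-1) - x' (- ln x')^(s-1), where x < x' are exchanged by the
    reflection.  For s >= 2 this is nonnegative because - u ln u takes a larger
    value at u = x^2 than at u = x'^2 = 1 - x^2, by concavity of ln
    ([gap_odd_ge0]).

    Consequently the inverse of 1 - sum_n q_n w^(n+1) has as coefficients the
    renewal sequence u_0 = 1, u_(n+1) = sum_i q_i u_(n-i).  It lies in [0, 1], so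
    its Cauchy powers grow subexponentially.  On the other hand y is close to 1
    when x is close to 0, so the q_n with n even, and with them the u_n, decay
    more slowly than any geometric sequence.  The n-th roots of the coefficients
    of the r-th power therefore tend to 1, and dividing the coefficients by p^n
    gives the limit 1 / p ([limn_esup_root]).

    These coefficients are the Taylor coefficients because a function with a
    geometrically controlled power series expansion at 0 may be differentiated
    term by term ([expansion_derive1], [taylor_coef_expansion]). *)

(** * Power series expansions at 0 with real coefficients *)

Section expansions.
Context {R : realType}.
Local Notation C := R[i].
Implicit Types (f g : C -> C) (a b : nat -> R).

(** A partial sum with N terms, hence of degree less than N. *)
Definition psum a (w : C) N : C := \sum_(n < N) (a n)%:C%C * w ^+ n.

(** The geometric error bound is what makes expansions stable under products and
    differentiation without any appeal to analytic function theory.  It holds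
    on the disk of radius 1 / (2 q) only: the Taylor coefficients see nothing
    but a neighbourhood of 0, and the freedom to enlarge q is used
    everywhere. *)
Definition expansion f a := exists M q : R, [/\ 0 <= M, 0 < q &
  forall w N, q * normc w <= 2^-1 ->
    normc (f w - psum a w N) <= M * (q * normc w) ^+ N].

Lemma normc_ge0 (z : C) : 0 <= normc z.
Proof. by case: z => x y; exact: sqrtr_ge0. Qed.

Lemma ler_normcD (x y : C) : normc (x + y) <= normc x + normc y.
Proof. exact: le_normcD. Qed.

Lemma normc_opp (x : C) : normc (- x) = normc x.
Proof. exact: normcN. Qed.

Lemma normc_real (x : R) : normc x%:C%C = `|x|.
Proof. by rewrite /= expr0n addr0 sqrtr_sqr. Qed.

Lemma normcX (z : C) n : normc (z ^+ n) = normc z ^+ n.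
Proof.
elim: n => [|n IH]; first by rewrite !expr0 normc1.
by rewrite !exprS normcM IH.
Qed.

Lemma ler_normc_sum (I : Type) (r : seq I) (F : I -> C) :
  normc (\sum_(i <- r) F i) <= \sum_(i <- r) normc (F i).
Proof.
elim/big_ind2 : _ => [|x1 x2 y1 y2 h1 h2|//]; first by rewrite normc0.
exact: le_trans (ler_normcD _ _) (lerD h1 h2).
Qed.

Lemma normcE_norm (z : C) : `|z| = (normc z)%:C%C.
Proof. by []. Qed.

Lemma geometric_sum_le (x : R) N : 0 <= x <= 2^-1 ->
  \sum_(n < N) x ^+ n <= 2.
Proof.
move=> /andP[x0 x2].
suff : \sum_(n < N) x ^+ n + 2 * x ^+ N <= 2.
  by have := exprn_ge0 N x0; lra.
elim: N => [|N IH]; first by rewrite big_ord0 expr0 add0r mulr1.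
rewrite big_ord_recr/= exprS; apply: le_trans IH.
have : x * x ^+ N <= 2^-1 * x ^+ N by rewrite ler_wpM2r// exprn_ge0.
lra.
Qed.

(** Lets a number of terms tend to infinity in an inequality. *)
Lemma le_add_halfpow (x y B : R) : 0 <= B ->
  (forall N, x <= y + B * 2^-1 ^+ N) -> x <= y.
Proof.
move=> B0 h; apply/ler_addgt0Pr => e e0.
have [N hN] : exists N, B * 2^-1 ^+ N <= e.
  have : (fun n => B * 2^-1 ^+ n) @ \oo --> B * 0.
    by apply: cvgMr; apply: cvg_expr; rewrite ger0_norm; lra.
  rewrite mulr0 => /cvgrPdist_le/(_ _ e0)[N _ /(_ N (leqnn _))].
  rewrite sub0r normrN => hN; exists N; exact: le_trans (ler_norm _) hN.
by apply: le_trans (h N) _; rewrite lerD2l.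
Qed.

Lemma psumS a w N : psum a w N.+1 = psum a w N + (a N)%:C%C * w ^+ N.
Proof. by rewrite /psum big_ord_recr. Qed.

(** The n-th term is the difference of two consecutive errors; it is evaluated at
    the boundary point 1 / (2 q). *)
Lemma expansion_coef_le {f a} {M q : R} : 0 <= M -> 0 < q ->
  (forall w N, q * normc w <= 2^-1 ->
    normc (f w - psum a w N) <= M * (q * normc w) ^+ N) ->
  forall n, `|a n| <= 2 * M * q ^+ n.
Proof.
move=> M0 q0 h n.
have q2 : 0 < (2 * q)^-1 by rewrite invr_gt0; lra.
set w : C := ((2 * q)^-1)%:C%C.
have nw : normc w = (2 * q)^-1 by rewrite normc_real gtr0_norm.
have qw : q * normc w = 2^-1 by rewrite nw; field; lra.
have := h w n; have := h w n.+1; rewrite qw lexx => /(_ isT) h1 /(_ isT) h0.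
have : normc ((a n)%:C%C * w ^+ n) <= 2 * M * 2^-1 ^+ n.
  have -> : (a n)%:C%C * w ^+ n = (f w - psum a w n) + - (f w - psum a w n.+1).
    by rewrite psumS; ring.
  apply: le_trans (ler_normcD _ _) _; rewrite normc_opp.
  apply: le_trans (lerD h0 h1) _; rewrite exprS.
  have : 0 <= M * 2^-1 ^+ n by rewrite mulr_ge0// exprn_ge0//; lra.
  lra.
rewrite normcM normcX nw normc_real.
have -> : 2^-1 = q * (2 * q)^-1 :> R by field; lra.
by rewrite exprMn mulrA ler_pM2r// exprn_gt0.
Qed.

(** The intervals of centre [v n] and radius 2 B x^n are nested, as x <= 1 / 2, so
    they have a common point. *)
Lemma geometric_limit (v : nat -> R) (B x : R) : 0 <= B -> 0 <= x <= 2^-1 ->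
  (forall n, `|v n.+1 - v n| <= B * x ^+ n) ->
  exists l, forall n, `|l - v n| <= 2 * B * x ^+ n.
Proof.
move=> B0 /andP[x0 x2] hv.
pose lo n := v n - 2 * B * x ^+ n; pose up n := v n + 2 * B * x ^+ n.
have Bx n : 2 * B * x ^+ n.+1 + B * x ^+ n <= 2 * B * x ^+ n.
  have : x * (B * x ^+ n) <= 2^-1 * (B * x ^+ n).
    by rewrite ler_wpM2r// mulr_ge0// exprn_ge0.
  by rewrite exprS; nra.
have lo_nd : {homo lo : m n / (m <= n)%N >-> m <= n}.
  apply/nondecreasing_seqP => n; rewrite /lo.
  by have := hv n; have := Bx n; rewrite ler_norml; lra.
have up_ni : {homo up : m n / (m <= n)%N >-> m >= n}.
  apply/nonincreasing_seqP => n; rewrite /up.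
  by have := hv n; have := Bx n; rewrite ler_norml; lra.
have lo_up m n : lo m <= up n.
  apply: le_trans (lo_nd _ _ (leq_maxl m n)) _.
  apply: le_trans (up_ni _ _ (leq_maxr m n)).
  rewrite /lo /up.
  by have := mulr_ge0 B0 (exprn_ge0 (maxn m n) x0); lra.
exists (sup (range lo)) => n.
have h1 : lo n <= sup (range lo).
  by apply: ub_le_sup; [exists (up 0%N) => _ [m _ <-]; exact: lo_up|exists n].
have h2 : sup (range lo) <= up n.
  by apply: ge_sup; [exists (lo 0%N), 0%N|move=> _ [m _ <-]; exact: lo_up].
by rewrite ler_norml; move: h1 h2; rewrite /lo /up; lra.
Qed.

Lemma normc_le_ReIm (z : C) : normc z <= `|complex.Re z| + `|complex.Im z|.
Proof.
case: z => x y /=; rewrite -[leRHS]ger0_norm; last by rewrite addr_ge0.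
rewrite -sqrtr_sqr ler_wsqrtr// sqrrD !real_normK ?num_real//.
by have := mulr_ge0 (normr_ge0 x) (normr_ge0 y); lra.
Qed.

Lemma Re_le_normc (z : C) : `|complex.Re z| <= normc z.
Proof.
by case: z => x y /=; rewrite -sqrtr_sqr ler_wsqrtr// lerDl sqr_ge0.
Qed.

Lemma Im_le_normc (z : C) : `|complex.Im z| <= normc z.
Proof.
by case: z => x y /=; rewrite -sqrtr_sqr ler_wsqrtr// lerDr sqr_ge0.
Qed.

Lemma geometric_limitC (v : nat -> C) (B x : R) : 0 <= B -> 0 <= x <= 2^-1 ->
  (forall n, normc (v n.+1 - v n) <= B * x ^+ n) ->
  exists l, forall n, normc (l - v n) <= 4 * B * x ^+ n.
Proof.
move=> B0 x0 hv.
have [n|l1 h1] := @geometric_limit (fun n => complex.Re (v n)) B x B0 x0.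
  have := Re_le_normc (v n.+1 - v n); case: (v n.+1) (v n) (hv n) => ? ? [? ?] /=.
  by move=> h /le_trans; apply.
have [n|l2 h2] := @geometric_limit (fun n => complex.Im (v n)) B x B0 x0.
  have := Im_le_normc (v n.+1 - v n); case: (v n.+1) (v n) (hv n) => ? ? [? ?] /=.
  by move=> h /le_trans; apply.
exists (Complex l1 l2) => n; apply: le_trans (normc_le_ReIm _) _.
have := h1 n; have := h2 n; case: (v n) => ? ? /=; lra.
Qed.

(** This is where completeness enters: a function with prescribed coefficients
    exists. *)
Lemma expansion_exists a (M q : R) : 0 <= M -> 0 < q ->
  (forall n, `|a n| <= M * q ^+ n) -> exists f, expansion f a.
Proof.
move=> M0 q0 ha.
have H w : exists l, q * normc w <= 2^-1 ->
    forall N, normc (l - psum a w N) <= 4 * M * (q * normc w) ^+ N.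
  have [qw|_] := leP (q * normc w) 2^-1; last by exists 0.
  have x0 : 0 <= q * normc w <= 2^-1 by rewrite qw mulr_ge0 ?normc_ge0// ltW.
  have [n|l hl] := @geometric_limitC (psum a w) M (q * normc w) M0 x0.
    rewrite psumS addrC addKr normcM normcX normc_real exprMn mulrA.
    by rewrite ler_wpM2r// exprn_ge0// normc_ge0.
  by exists l.
have [f hf] := choice H.
by exists f, (4 * M), q; split => //; [rewrite mulr_ge0|move=> w N /hf].
Qed.

Definition cauchy_prod a b n := \sum_(i < n.+1) a i * b (n - i)%N.

(** Truncating the Cauchy product at degree N amounts to truncating the second
    factor at a degree that depends on the term of the first one. *)
Lemma psum_cauchy_prod a b w N : psum (cauchy_prod a b) w N =
  \sum_(i < N) (a i)%:C%C * w ^+ i * psum b w (N - i)%N.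
Proof.
elim: N => [|N IH]; first by rewrite /psum !big_ord0.
rewrite psumS {}IH big_ord_recr/= subSnn.
have -> : psum b w 1 = (b 0%N)%:C%C by rewrite /psum big_ord1 expr0 mulr1.
under [in RHS]eq_bigr => i _.
  rewrite (subSn (ltnW (ltn_ord i))) psumS mulrDr; over.
rewrite big_split/= -addrA; congr (_ + _).
rewrite /cauchy_prod rmorph_sum/= mulr_suml big_ord_recr/= subnn; congr (_ + _).
  apply: eq_bigr => i _; rewrite rmorphM/=.
  by rewrite mulrACA -exprD subnKC// ltnW.
by rewrite rmorphM/=; ring.
Qed.

Lemma ler_pow_base (x y : R) N : 0 <= x <= y -> x ^+ N <= y ^+ N.
Proof. by move=> /andP[x0 xy]; apply: lerXn2r => //; rewrite nnegrE// (le_trans x0). Qed.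

Lemma natr_le_exp2 n : n%:R <= 2 ^+ n :> R.
Proof. by rewrite -natrX ler_nat ltnW// ltn_expl. Qed.

Lemma expansion_widen {f a} {M q M' q' : R} : 0 <= M <= M' -> 0 < q <= q' ->
  (forall w N, q * normc w <= 2^-1 ->
    normc (f w - psum a w N) <= M * (q * normc w) ^+ N) ->
  (forall w N, q' * normc w <= 2^-1 ->
    normc (f w - psum a w N) <= M' * (q' * normc w) ^+ N).
Proof.
move=> /andP[M0 MM'] /andP[q0 qq'] h w N hw.
have qw : q * normc w <= q' * normc w by rewrite ler_wpM2r// normc_ge0.
have qw0 : 0 <= q * normc w by rewrite mulr_ge0 ?normc_ge0// ltW.
apply: le_trans (h _ _ (le_trans qw hw)) _.
by rewrite ler_pM ?exprn_ge0//; apply: ler_pow_base; rewrite qw0.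
Qed.

(** By [psum_cauchy_prod] the error is that of f times g, plus the terms of f
    times the errors of g.  The latter number N, and N <= 2^N is absorbed by
    doubling q. *)
Lemma expansionM f g a b : expansion f a -> expansion g b ->
  expansion (fun w => f w * g w) (cauchy_prod a b).
Proof.
move=> [M1 [q1 [M10 q10 h1]]] [M2 [q2 [M20 q20 h2]]].
pose M := M1 + M2; pose q := q1 + q2.
have M0 : 0 <= M by rewrite addr_ge0.
have q0 : 0 < q by rewrite addr_gt0.
have {h1}hf : forall w N, q * normc w <= 2^-1 ->
    normc (f w - psum a w N) <= M * (q * normc w) ^+ N.
  by apply: expansion_widen h1; rewrite ?M10 ?q10/= ?lerDl// ltW.
have {h2}hg : forall w N, q * normc w <= 2^-1 ->
    normc (g w - psum b w N) <= M * (q * normc w) ^+ N.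
  by apply: expansion_widen h2; rewrite ?M20 ?q20/= ?lerDr// ltW.
have ha := expansion_coef_le M0 q0 hf.
exists (3 * M ^+ 2), (2 * q); split; [by rewrite mulr_ge0// sqr_ge0|lra|].
move=> w N hw; set x := q * normc w.
have x0 : 0 <= x by rewrite mulr_ge0 ?normc_ge0// ltW.
have qw : q * normc w <= 2^-1 by move: hw; rewrite -/x -mulrA -/x; lra.
have gM : normc (g w) <= M.
  by have := hg w 0%N qw; rewrite /psum big_ord0 subr0 expr0 mulr1.
have -> : f w * g w - psum (cauchy_prod a b) w N = (f w - psum a w N) * g w +
   \sum_(i < N) (a i)%:C%C * w ^+ i * (g w - psum b w (N - i)%N).
  rewrite psum_cauchy_prod mulrBl [psum a w N in RHS]/psum mulr_suml.
  rewrite [X in _ = _ + X](_ : _ = \sum_(i < N) (a i)%:C%C * w ^+ i * g w -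
      \sum_(i < N) (a i)%:C%C * w ^+ i * psum b w (N - i)%N); first by ring.
  by rewrite -sumrB; apply: eq_bigr => i _; rewrite mulrBr.
apply: le_trans (ler_normcD _ _) _.
have S1 : normc ((f w - psum a w N) * g w) <= M ^+ 2 * x ^+ N.
  rewrite normcM expr2 mulrAC.
  by apply: ler_pM => //; rewrite ?normc_ge0//; exact: hf.
have S2 : normc (\sum_(i < N) (a i)%:C%C * w ^+ i * (g w - psum b w (N - i)%N))
    <= N%:R * (2 * M ^+ 2 * x ^+ N).
  apply: le_trans (ler_normc_sum _ _ _) _.
  have -> : N%:R * (2 * M ^+ 2 * x ^+ N) = \sum_(i < N) (2 * M ^+ 2 * x ^+ N).
    by rewrite sumr_const card_ord mulr_natl.
  apply: ler_sum => i _.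
  rewrite !normcM normc_real normcX.
  have -> : 2 * M ^+ 2 * x ^+ N =
      (2 * M * q ^+ i) * normc w ^+ i * (M * x ^+ (N - i)).
    rewrite -{1}(subnKC (ltnW (ltn_ord i))) exprD {2}/x exprMn; ring.
  apply: ler_pM; rewrite ?mulr_ge0 ?exprn_ge0 ?normc_ge0//.
    by rewrite ler_wpM2r// exprn_ge0// normc_ge0.
  exact: hg.
apply: le_trans (lerD S1 S2) _.
have -> : 2 * q * normc w = 2 * x by rewrite mulrA.
rewrite [(2 * x) ^+ N]exprMn.
have h2 := natr_le_exp2 N.
have h1 : 1 <= 2 ^+ N :> R by rewrite exprn_ege1//; lra.
have Mx : 0 <= M ^+ 2 * x ^+ N by rewrite mulr_ge0 ?sqr_ge0 ?exprn_ge0.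
have {h1}h1 := ler_wpM2r Mx h1; have {h2}h2 := ler_wpM2r Mx h2.
have -> : 3 * M ^+ 2 * (2 ^+ N * x ^+ N) = 3 * (2 ^+ N * (M ^+ 2 * x ^+ N)).
  by ring.
have -> : N%:R * (2 * M ^+ 2 * x ^+ N) = 2 * (N%:R * (M ^+ 2 * x ^+ N)).
  by ring.
lra.
Qed.

(** Coefficients of the derivative. *)
Definition dcoef a n := n.+1%:R * a n.+1.

(** The factor n + 1 is absorbed by doubling q. *)
Lemma dcoef_le a (M q : R) : 0 <= M -> 0 < q ->
  (forall n, `|a n| <= M * q ^+ n) ->
  forall n, `|dcoef a n| <= 2 * M * q * (2 * q) ^+ n.
Proof.
move=> M0 q0 ha n; rewrite /dcoef normrM ger0_norm//.
have -> : 2 * M * q * (2 * q) ^+ n = 2 ^+ n.+1 * (M * q ^+ n.+1).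
  by rewrite exprMn !exprS; ring.
by apply: ler_pM => //; exact: natr_le_exp2.
Qed.

(** A second-order Taylor bound for powers; multiplying by r^2 avoids the negative
    power r^(n-1), and 2^(n+1) replaces the sharp constant n (n+1) / 2. *)
Lemma pow_taylor2_le (w h : C) (r : R) n : normc w <= r -> normc (w + h) <= r ->
  r ^+ 2 * normc ((w + h) ^+ n.+1 - w ^+ n.+1 - n.+1%:R * h * w ^+ n) <=
  normc h ^+ 2 * (2 * r) ^+ n.+1.
Proof.
move=> wr whr.
have r0 : 0 <= r by exact: le_trans (normc_ge0 w) wr.
elim: n => [|n IH].
  rewrite !expr1 expr0 mulr1 mul1r (_ : w + h - w - h = 0); last by ring.
  by rewrite normc0 mulr0 mulr_ge0 ?exprn_ge0 ?normc_ge0// mulr_ge0.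
have -> : (w + h) ^+ n.+2 - w ^+ n.+2 - n.+2%:R * h * w ^+ n.+1 =
   (w + h) * ((w + h) ^+ n.+1 - w ^+ n.+1 - n.+1%:R * h * w ^+ n) +
   n.+1%:R * h ^+ 2 * w ^+ n.
  by rewrite -[n.+2%:R]natr1 !exprS; ring.
apply: le_trans (ler_wpM2l (sqr_ge0 r) (ler_normcD _ _)) _.
rewrite mulrDr.
have S1 : r ^+ 2 * normc ((w + h) *
    ((w + h) ^+ n.+1 - w ^+ n.+1 - n.+1%:R * h * w ^+ n)) <=
    r * (normc h ^+ 2 * (2 * r) ^+ n.+1).
  by rewrite normcM mulrCA; apply: ler_pM; rewrite ?mulr_ge0 ?normc_ge0 ?sqr_ge0.
have S2 : r ^+ 2 * normc (n.+1%:R * h ^+ 2 * w ^+ n) <= r * (normc h ^+ 2 * (2 * r) ^+ n.+1).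
  rewrite !normcM !normcX.
  have -> : normc (n.+1%:R : C) = n.+1%:R.
    by rewrite -(rmorph_nat (real_complex R)) normc_real ger0_norm.
  have -> : r * (normc h ^+ 2 * (2 * r) ^+ n.+1) =
     r ^+ 2 * (2 ^+ n.+1 * normc h ^+ 2 * r ^+ n) by rewrite exprMn !exprS; ring.
  rewrite ler_wpM2l ?sqr_ge0// ler_pM ?mulr_ge0 ?exprn_ge0 ?normc_ge0//.
    by rewrite ler_wpM2r ?sqr_ge0//; exact: natr_le_exp2.
  by apply: ler_pow_base; rewrite normc_ge0.
apply: le_trans (lerD S1 S2) _; rewrite [(2 * r) ^+ n.+2]exprS.
by rewrite le_eqVlt; apply/orP; left; apply/eqP; ring.
Qed.

(** Sums [pow_taylor2_le] over the terms of the series.  The radius 1 / (4 q)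
    makes the resulting series geometric of ratio 1 / 2; the three truncation
    errors vanish when the number of terms tends to infinity. *)
Lemma expansion_derivative_le f g a : expansion f a -> expansion g (dcoef a) ->
  exists K r : R, [/\ 0 <= K, 0 < r & forall w h, normc w <= r -> normc h <= r ->
    normc (f (w + h) - f w - h * g w) <= K * normc h ^+ 2].
Proof.
move=> [M1 [q1 [M10 q10 h1]]] [M2 [q2 [M20 q20 h2]]].
pose M := M1 + M2; pose q := q1 + q2.
have M0 : 0 <= M by rewrite addr_ge0.
have q0 : 0 < q by rewrite addr_gt0.
have {h1}hf : forall w N, q * normc w <= 2^-1 ->
    normc (f w - psum a w N) <= M * (q * normc w) ^+ N.
  by apply: expansion_widen h1; rewrite ?M10 ?q10/= ?lerDl// ltW.
have {h2}hg : forall w N, q * normc w <= 2^-1 ->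
    normc (g w - psum (dcoef a) w N) <= M * (q * normc w) ^+ N.
  by apply: expansion_widen h2; rewrite ?M20 ?q20/= ?lerDr// ltW.
have ha := expansion_coef_le M0 q0 hf.
pose r := (4 * q)^-1.
have r0 : 0 < r by rewrite invr_gt0; lra.
have qr : 2 * q * r = 2^-1 by rewrite /r; field; lra.
exists (4 * M / r ^+ 2), (r / 2); split.
- by rewrite divr_ge0 ?sqr_ge0//; lra.
- lra.
move=> w h wr hr.
have whr : normc (w + h) <= r by apply: le_trans (ler_normcD _ _) _; lra.
have {}wr : normc w <= r by lra.
have {}hr : normc h <= 1 * r by lra.
have hq z : normc z <= r -> q * normc z <= 2^-1.
  move=> zr; have := ler_wpM2l (ltW q0) zr; have : 0 < q * r by rewrite mulr_gt0.
  lra.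
pose c := normc h; have c0 : 0 <= c := normc_ge0 h.
apply: (@le_add_halfpow _ _ ((2 + c) * M)); first by rewrite mulr_ge0// addr_ge0.
move=> N.
have bnd (F : C -> C) b z n : normc z <= r ->
    (forall w N, q * normc w <= 2^-1 ->
    normc (F w - psum b w N) <= M * (q * normc w) ^+ N) ->
    (N <= n)%N ->
    normc (F z - psum b z n) <= M * 2^-1 ^+ N.
  move=> zr hF Nn; apply: le_trans (hF _ _ (hq _ zr)) _.
  rewrite ler_wpM2l//; apply: (@le_trans _ _ (2^-1 ^+ n)).
    by apply: ler_pow_base; rewrite hq// mulr_ge0 ?normc_ge0// ltW.
  by rewrite ler_wiXn2l//; lra.
have -> : f (w + h) - f w - h * g w =
    \sum_(n < N) (a n.+1)%:C%C *
      ((w + h) ^+ n.+1 - w ^+ n.+1 - n.+1%:R * h * w ^+ n) +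
    ((f (w + h) - psum a (w + h) N.+1) +
     (- (f w - psum a w N.+1) + - (h * (g w - psum (dcoef a) w N)))).
  have -> : \sum_(n < N) (a n.+1)%:C%C *
      ((w + h) ^+ n.+1 - w ^+ n.+1 - n.+1%:R * h * w ^+ n) =
      psum a (w + h) N.+1 - psum a w N.+1 - h * psum (dcoef a) w N.
    rewrite /psum !big_ord_recl !expr0 mulr_sumr.
    rewrite opprD addrACA subrr add0r -!sumrB; apply: eq_bigr => i _.
    by rewrite /bump/= /dcoef rmorphM/= rmorph_nat; ring.
  by ring.
apply: le_trans (ler_normcD _ _) _; apply: lerD; last first.
  rewrite !mulrDl; apply: le_trans (ler_normcD _ _) _.
  have B1 := bnd _ _ _ _ whr hf (leqnSn N).
  have B2 := bnd _ _ _ _ wr hf (leqnSn N).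
  have B3 := bnd _ _ _ _ wr hg (leqnn N).
  have := ler_normcD (- (f w - psum a w N.+1)) (- (h * (g w - psum (dcoef a) w N))).
  rewrite !normc_opp normcM -/c; have := ler_wpM2l c0 B3; lra.
apply: le_trans (ler_normc_sum _ _ _) _.
apply: (@le_trans _ _ (\sum_(n < N) 2 * M / r ^+ 2 * c ^+ 2 * 2^-1 ^+ n)).
  apply: ler_sum => i _; rewrite normcM normc_real.
  have P := pow_taylor2_le _ _ _ i wr whr.
  rewrite -(ler_pM2l (exprn_gt0 2 r0)) mulrCA.
  apply: (@le_trans _ _ (2 * M * q ^+ i.+1 * (c ^+ 2 * (2 * r) ^+ i.+1))).
    by apply: ler_pM; rewrite // mulr_ge0 ?sqr_ge0 ?normc_ge0.
  have -> : 2 * M * q ^+ i.+1 * (c ^+ 2 * (2 * r) ^+ i.+1) =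
            2 * M * c ^+ 2 * (2 * q * r) ^+ i.+1 by rewrite !exprMn; ring.
  rewrite qr [2^-1 ^+ i.+1]exprS.
  have -> : r ^+ 2 * (2 * M / r ^+ 2 * c ^+ 2 * 2^-1 ^+ i) = 2 * M * c ^+ 2 * 2^-1 ^+ i.
    by field; lra.
  have h2 : 0 <= 2^-1 :> R by lra.
  rewrite ler_wpM2l ?mulr_ge0 ?sqr_ge0// ler_piMl ?exprn_ge0//; lra.
rewrite -mulr_sumr.
have -> : 4 * M / r ^+ 2 * normc h ^+ 2 = 2 * M / r ^+ 2 * c ^+ 2 * 2 by rewrite /c; ring.
rewrite ler_wpM2l ?geometric_sum_le//; last by apply/andP; split; lra.
by rewrite !mulr_ge0 ?sqr_ge0// invr_ge0 sqr_ge0.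
Qed.

End expansions.

(** * Taylor coefficients of an expansion *)

Section taylor.
Context {R : realType}.
Local Notation C := R[i].
Implicit Types (f g : C -> C) (a b : nat -> R).

Lemma expansion_near f g a (r : R) : 0 < r ->
  (forall w, normc w <= r -> f w = g w) -> expansion g a -> expansion f a.
Proof.
move=> r0 fg [M [q [M0 q0 h]]].
have r20 : 0 < (2 * r)^-1 by rewrite invr_gt0; lra.
exists M, (q + (2 * r)^-1); split; [by []|lra|].
move=> w N hw; rewrite fg.
  by apply: (expansion_widen _ _ h); rewrite ?M0 ?q0//= lerDl ltW.
have : (2 * r)^-1 * normc w <= 2^-1.
  by apply: le_trans hw; rewrite ler_wpM2r ?normc_ge0// lerDr ltW.
by rewrite invfM -mulrA ger_pMr// mulrC ler_pdivrMr// mul1r.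
Qed.

(** The derivative agrees near 0 with the function whose coefficients are
    [dcoef a], by [expansion_derivative_le]. *)
Lemma expansion_derive1 (f : C^o -> C^o) a :
  expansion f a -> expansion (f^`())%classic (dcoef a).
Proof.
move=> fa; have [M [q [M0 q0 h]]] := fa.
have [g ga] : exists g, expansion g (dcoef a).
  have M2 : 0 <= 2 * M by lra.
  apply: (expansion_exists _ (2 * (2 * M) * q) (2 * q)); [|lra|].
    by rewrite !mulr_ge0// ltW.
  exact: dcoef_le (expansion_coef_le M0 q0 h).
have [K [r [K0 r0 H]]] := expansion_derivative_le _ _ _ fa ga.
apply: (@expansion_near _ g _ r r0) => // w wr.
apply: (@cvg_lim C^o (@norm_hausdorff C C^o)).
apply/cvgrPdist_le => /= e e0.
have eE : e = (complex.Re e)%:C%C.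
  by move: e0; rewrite ltcE => /andP[/eqP]; case: e => x y /= -> _.
have e0' : 0 < complex.Re e by move: e0; rewrite eE ltcR.
pose d := Num.min r (complex.Re e / (K + 1)).
have d0 : 0 < d by rewrite lt_min r0 divr_gt0//; lra.
near=> t.
have t0 : t != 0 by near: t; exact: (@nbhs_dnbhs_neq C^o 0).
have td : normc t <= d.
  rewrite -lecR -normcE_norm; apply: ltW; near: t.
  apply: (@dnbhs0_lt C C^o); by rewrite ltcR.
have nt0 : 0 < normc t.
  by rewrite lt_neqAle normc_ge0 andbT eq_sym; apply: contra_neq t0 => /eq0_normc.
have tr : normc t <= r by apply: le_trans td _; rewrite ge_min lexx.
have te : K * normc t <= complex.Re e.
  have : normc t <= complex.Re e / (K + 1).
    by apply: le_trans td _; rewrite ge_min lexx orbT.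
  rewrite ler_pdivlMr; last lra.
  nra.
rewrite normcE_norm eE lecR.
have -> : g w - t^-1 *: (f (t + w) - f w) =
    - t^-1 * (f (w + t) - f w - t * g w).
  by rewrite [t + w]addrC /GRing.scale/=; field.
rewrite normcM normc_opp normcV ler_pdivrMl//.
apply: le_trans (H _ _ wr tr) _.
by rewrite expr2 mulrA mulrC ler_wpM2l// ltW.
Unshelve. all: by end_near. Qed.

(** The product with m! avoids a quotient of factorials. *)
Lemma iter_dcoef a n m :
  iter n dcoef a m * m`!%:R = (m + n)`!%:R * a (m + n)%N.
Proof.
elim: n m => [|n IH] m; first by rewrite addn0 mulrC.
rewrite iterS {1}/dcoef addnS -addSn -IH factS natrM; ring.
Qed.

Lemma taylor_coef_expansion (f : C^o -> C^o) a n : expansion f a ->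
  taylor_coef f n = (a n)%:C%C.
Proof.
move=> fa; have H : expansion (f^`(n))%classic (iter n dcoef a).
  by elim: n => [//|n IH]; rewrite iterS derive1nS; exact: expansion_derive1.
have [M [q [M0 q0 /(_ 0 1%N)]]] := H.
rewrite normc0 mulr0 expr1 mulr0 invr_ge0 ler0n => /(_ isT) h.
have {h} : normc ((f^`(n))%classic 0 - psum (iter n dcoef a) 0 1) = 0.
  by apply/eqP; rewrite eq_le h normc_ge0.
move=> /eq0_normc/eqP; rewrite subr_eq0 => /eqP fn.
rewrite /taylor_coef fn /psum big_ord1 expr0 mulr1.
have := iter_dcoef a n 0; rewrite fact0 mulr1 add0n => ->.
by rewrite rmorphM/= rmorph_nat mulrC mulKf// pnatr_eq0 -lt0n fact_gt0.
Qed.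

End taylor.

(** * Powers and inverses of expansions *)

Section expansion_algebra.
Context {R : realType}.
Local Notation C := R[i].
Implicit Types (f g : C -> C) (a b : nat -> R).

(** The unit of the Cauchy product. *)
Definition delta0 (n : nat) : R := (n == 0%N)%:R.

Definition cauchy_pow a r : nat -> R := iter r (cauchy_prod a) delta0.

Lemma eq_expansion f a b : a =1 b -> expansion f a -> expansion f b.
Proof. by move=> /funext ->. Qed.

Lemma expansionZ f a (c : R) : expansion f a ->
  expansion (fun w => c%:C%C * f w) (fun n => c * a n).
Proof.
move=> [M [q [M0 q0 h]]]; exists (`|c| * M), q; split => //.
  by rewrite mulr_ge0.
move=> w N /h hw; rewrite (_ : psum _ w N = c%:C%C * psum a w N).
  by rewrite -mulrBr normcM normc_real -mulrA ler_wpM2l.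
by rewrite /psum mulr_sumr; apply: eq_bigr => i _; rewrite rmorphM/= mulrA.
Qed.

Lemma psum_delta0 (w : C) N : psum delta0 w N.+1 = 1.
Proof.
rewrite /psum big_ord_recl big1 => [|i _].
  by rewrite /delta0 expr0 mulr1 addr0.
by rewrite /delta0/= mul0r.
Qed.

Lemma expansion1 : expansion (fun=> 1 : C) delta0.
Proof.
exists 1, 1; split=> // w [|N] _.
  by rewrite /psum big_ord0 subr0 normc1 expr0 mulr1.
by rewrite psum_delta0 subrr normc0 mulr_ge0 ?exprn_ge0 ?mul1r ?normc_ge0.
Qed.

Lemma expansionX f a r : expansion f a ->
  expansion (fun w => f w ^+ r) (cauchy_pow a r).
Proof.
move=> fa; elim: r => [|r IH].
  rewrite [fun w => _](_ : _ = fun=> 1); first exact: expansion1.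
  by apply/funext => w; rewrite expr0.
rewrite [fun w => _](_ : _ = fun w => f w * f w ^+ r); first exact: expansionM.
by apply/funext => w; rewrite exprS.
Qed.

Lemma expansion_unique f g a : expansion f a -> expansion g a ->
  exists2 r : R, 0 < r & forall w, normc w <= r -> f w = g w.
Proof.
move=> [M1 [q1 [M10 q10 h1]]] [M2 [q2 [M20 q20 h2]]].
exists (2 * (q1 + q2))^-1 => [|w wr]; first by rewrite invr_gt0; lra.
have w0 := normc_ge0 w.
have qw : (q1 + q2) * normc w <= 2^-1.
  by rewrite mulrC -ler_pdivlMr; [rewrite -invfM|lra].
have q1w : 0 <= q1 * normc w <= 2^-1.
  by have := mulr_ge0 (ltW q20) w0; have := mulr_ge0 (ltW q10) w0; lra.
have q2w : 0 <= q2 * normc w <= 2^-1.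
  by have := mulr_ge0 (ltW q20) w0; have := mulr_ge0 (ltW q10) w0; lra.
apply/eqP; rewrite -subr_eq0; apply/eqP/eq0_normc/eqP.
rewrite eq_le normc_ge0 andbT; apply: (@le_add_halfpow _ _ 0 (M1 + M2)).
  exact: addr_ge0.
move=> N; rewrite add0r mulrDl.
have -> : f w - g w = (f w - psum a w N) + - (g w - psum a w N) by ring.
apply: le_trans (ler_normcD _ _) _; rewrite normc_opp.
have H1 := h1 w N (proj2 (andP q1w)); have H2 := h2 w N (proj2 (andP q2w)).
apply: lerD; [apply: le_trans H1 _|apply: le_trans H2 _].
  by rewrite ler_wpM2l//; exact: ler_pow_base.
by rewrite ler_wpM2l//; exact: ler_pow_base.
Qed.

(** If g has the coefficients b, then f g has the expansion of 1, so f g = 1 near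
    0, which also shows that f does not vanish there. *)
Lemma expansionV f a b (M q : R) : 0 <= M -> 0 < q ->
  (forall n, `|b n| <= M * q ^+ n) -> cauchy_prod a b =1 delta0 ->
  expansion f a -> expansion (fun w => (f w)^-1) b.
Proof.
move=> M0 q0 hb ab fa.
have [g gb] := expansion_exists _ _ _ M0 q0 hb.
have [r r0 fg] := expansion_unique _ _ _
  (eq_expansion _ _ _ ab (expansionM _ _ _ _ fa gb)) expansion1.
apply: (expansion_near _ g _ r) => // w /fg fgw.
have f0 : f w != 0.
  by apply/eqP => fw0; move: fgw; rewrite fw0 mul0r => /esym/eqP; rewrite oner_eq0.
by apply: (mulfI f0); rewrite mulfV.
Qed.

End expansion_algebra.

(** * Renewal sequences *)

Section renewal_sequence.
Context {R : realType}.

(** The values at n, n - 1, ..., 0, in this order, so that the k-th entry of the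
    list built so far is the one that [q k] multiplies. *)
Fixpoint renewal_rev (q : nat -> R) n : seq R :=
  if n is m.+1 then
    let s := renewal_rev q m in (\sum_(k < m.+1) q k * s`_k) :: s
  else [:: 1].

Definition renewal q n : R := (renewal_rev q n)`_0.

Lemma nth_renewal_rev q n k : (k <= n)%N ->
  (renewal_rev q n)`_k = renewal q (n - k).
Proof.
elim: n k => [|n IH] [|k] //= kn; exact: IH.
Qed.

Lemma renewalS q n : renewal q n.+1 = cauchy_prod q (renewal q) n.
Proof.
by apply: eq_bigr => k _; rewrite nth_renewal_rev// -ltnS.
Qed.

(** Coefficients of 1 - sum_n q_n w^(n+1). *)
Definition renewal_eq_coef q n : R := if n is m.+1 then - q m else 1.

Lemma cauchy_prod_renewal q : cauchy_prod (renewal_eq_coef q) (renewal q) =1 delta0.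
Proof.
move=> [|n]; first by rewrite /cauchy_prod big_ord1 /= mul1r.
rewrite /cauchy_prod big_ord_recl /= mul1r subn0 renewalS /cauchy_prod -big_split big1//= => i _.
by rewrite /bump/= add1n subSS mulNr addrN.
Qed.

Section renewal_bounds.
Variable q : nat -> R.
Hypothesis q0 : forall n, 0 <= q n.

Lemma renewal_ge0 n : 0 <= renewal q n.
Proof.
have [m] := ubnP n; elim: m n => // m IH [|n] nm; first exact: ler01.
rewrite renewalS sumr_ge0// => i _; rewrite mulr_ge0// IH//.
by rewrite (leq_ltn_trans (leq_subr _ _)).
Qed.

Lemma renewal_le1 n : (forall N, \sum_(k < N) q k <= 1) -> renewal q n <= 1.
Proof.
move=> q1; have [m] := ubnP n; elim: m n => // m IH [|n] nm; first exact: lexx.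
rewrite renewalS; apply: le_trans (q1 n.+1); apply: ler_sum => i _.
by rewrite ler_piMr// IH// (leq_ltn_trans (leq_subr _ _)).
Qed.

(** The term of index n of the recurrence contains [renewal q 0], which is 1. *)
Lemma renewal_ge n : q n <= renewal q n.+1.
Proof.
rewrite renewalS /cauchy_prod big_ord_recr/= subnn mulr1 lerDr sumr_ge0// => i _.
by rewrite mulr_ge0// renewal_ge0.
Qed.

(** Two steps cost a factor [q 0]; this transports lower bounds known for even
    indices only to the indices of the other parity. *)
Lemma renewal_ge2 n : q 0 * q n <= renewal q n.+2.
Proof.
rewrite renewalS /cauchy_prod big_ord_recl/= subn0.
apply: ler_wpDr; last by rewrite ler_wpM2l// renewal_ge.
by apply: sumr_ge0 => i _; rewrite mulr_ge0// renewal_ge0.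
Qed.

End renewal_bounds.

End renewal_sequence.

(** * Subexponential sequences and n-th roots *)

Section subexponential.
Context {R : realType}.
Implicit Types (a b u : nat -> R).

(** For u >= 0 this says that limsup u_n^(1/n) <= 1, in a form that is visibly
    insensitive to constant factors. *)
Definition slow_growth u := forall e : R, 0 < e < 1 ->
  exists2 A, 0 <= A & forall n, u n <= A * (1 + e) ^+ n.

Definition slow_decay u := forall e : R, 0 < e < 1 ->
  exists2 A, 0 < A & forall n, A * (1 - e) ^+ n <= u n.

Lemma cauchy_prod_ge0 a b : (forall n, 0 <= a n) -> (forall n, 0 <= b n) ->
  forall n, 0 <= cauchy_prod a b n.
Proof. by move=> a0 b0 n; apply: sumr_ge0 => i _; rewrite mulr_ge0. Qed.

(** There are n + 1 terms, and n + 1 is itself subexponential. *)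
Lemma slow_growthM a b : (forall n, 0 <= a n) -> (forall n, 0 <= b n) ->
  slow_growth a -> slow_growth b -> slow_growth (cauchy_prod a b).
Proof.
move=> a0 b0 ha hb e /andP[e0 e1].
have e2 : 0 < e / 2 < 1 by lra.
have e4 : 0 < e / 4 by lra.
have [A A0 hA] := ha _ e2; have [B B0 hB] := hb _ e2.
exists (A * B * (e / 4)^-1).
  by rewrite mulr_ge0 ?mulr_ge0// invr_ge0 ltW.
move=> n.
have S : cauchy_prod a b n <= A * B * (n.+1%:R * (1 + e / 2) ^+ n).
  have -> : A * B * (n.+1%:R * (1 + e / 2) ^+ n) =
      \sum_(i < n.+1) A * B * (1 + e / 2) ^+ n.
    by rewrite sumr_const card_ord -mulr_natl; ring.
  apply: ler_sum => i _.
  have -> : (1 + e / 2) ^+ n = (1 + e / 2) ^+ i * (1 + e / 2) ^+ (n - i).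
    by rewrite -exprD subnKC// leq_ord.
  rewrite mulrACA.
  exact: ler_pM.
apply: le_trans S _; rewrite -!mulrA ler_wpM2l// ler_wpM2l//.
rewrite ler_pdivlMl//.
  (* The factor n + 1 is paid for by (1 + e/2) (1 + e/4) <= 1 + e. *)
have bern : (n.+1%:R * (e / 4)) <= (1 + e / 4) ^+ n.
  elim: n => [|n IH]; first by rewrite expr0 mul1r; lra.
  have h1 : 1 <= (1 + e / 4) ^+ n by rewrite exprn_ege1//; lra.
  have := ler_wpM2l (ltW e4) h1; rewrite exprS.
  have -> : n.+2%:R = n.+1%:R + 1 :> R by rewrite natr1.
  lra.
rewrite mulrA [e / 4 * _]mulrC.
apply: (@le_trans _ _ ((1 + e / 4) ^+ n * (1 + e / 2) ^+ n)).
  by rewrite ler_wpM2r// exprn_ge0//; lra.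
by rewrite -exprMn; apply: ler_pow_base; apply/andP; split; nra.
Qed.

Lemma slow_growth_bounded u (A : R) : (forall n, u n <= A) -> 0 <= A -> slow_growth u.
Proof.
move=> uA A0 e /andP[e0 _]; exists A => // n; apply: le_trans (uA n) _.
by rewrite ler_peMr// exprn_ege1//; lra.
Qed.

Lemma cauchy_pow_ge0 u r n : (forall n, 0 <= u n) -> 0 <= cauchy_pow u r n.
Proof.
by move=> u0; elim: r n => [|r IH] n; [rewrite ler0n|exact: cauchy_prod_ge0].
Qed.

Lemma slow_growthX u r : (forall n, 0 <= u n) -> slow_growth u -> slow_growth (cauchy_pow u r).
Proof.
move=> u0 hu; elim: r => [|r IH].
  apply: (@slow_growth_bounded _ 1) => // n.
  by rewrite /cauchy_pow /delta0 /=; case: eqP.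
by apply: slow_growthM => // n; exact: cauchy_pow_ge0.
Qed.

(** The term of the Cauchy power in which all but one factor are [u 0] is a lower
    bound. *)
Lemma slow_decayX u r : (0 < r)%N -> u 0%N = 1 -> (forall n, 0 <= u n) ->
  slow_decay u -> slow_decay (cauchy_pow u r).
Proof.
move=> r0 u1 u0 hu e /hu[A A0 hA]; exists A => // n; apply: le_trans (hA n) _.
case: r r0 => // r _.
rewrite /cauchy_pow iterS -/(cauchy_pow u r) /cauchy_prod big_ord_recr/= subnn.
have -> : cauchy_pow u r 0 = 1.
  elim: r => [//|r IH].
  by rewrite /cauchy_pow iterS -/(cauchy_pow u r) /cauchy_prod big_ord1/= IH u1 mul1r.
by rewrite mulr1 lerDr sumr_ge0// => i _; rewrite mulr_ge0// cauchy_pow_ge0.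
Qed.

Lemma slow_growthZ u (c : R) : 0 <= c -> slow_growth u -> slow_growth (fun n => c * u n).
Proof.
move=> c0 hu e /hu[A A0 hA]; exists (c * A); first exact: mulr_ge0.
by move=> n; rewrite -mulrA ler_wpM2l.
Qed.

Lemma slow_decayZ u (c : R) : 0 < c -> slow_decay u -> slow_decay (fun n => c * u n).
Proof.
move=> c0 hu e /hu[A A0 hA]; exists (c * A); first exact: mulr_gt0.
by move=> n; rewrite -mulrA ler_wpM2l// ltW.
Qed.

Lemma renewal_slow_decay q : (forall n, 0 <= q n) ->
  (forall e : R, 0 < e < 1 ->
    exists2 A, 0 < A & forall n, ~~ odd n -> A * (1 - e) ^+ n <= q n) ->
  slow_decay (renewal q).
Proof.
move=> q0 hq e e01; have [A A0 hA] := hq e e01.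
have /andP[e0 e1] := e01.
have q00 : 0 < q 0 by have := hA 0%N isT; rewrite expr0 mulr1; exact: lt_le_trans.
pose B := Num.min 1 (Num.min A (q 0 * A)).
have B0 : 0 < B by rewrite !lt_min ltr01 A0 mulr_gt0.
have le_trans_pow (a b : R) m d : 0 <= a <= b -> a * (1 - e) ^+ (m + d) <= b * (1 - e) ^+ m.
  move=> /andP[a0 ab]; apply: ler_pM => //; first by rewrite exprn_ge0//; lra.
  by rewrite ler_wiXn2l ?leq_addr//; lra.
exists B => // -[|m]; first by rewrite expr0 mulr1 ge_min lexx.
have [om|em] := boolP (odd m); last first.
  apply: le_trans (renewal_ge _ q0 m); apply: le_trans (hA m em).
  by rewrite -addn1; apply: le_trans_pow; rewrite ltW//= !ge_min lexx orbT.
case: m om => // m om.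
apply: le_trans (renewal_ge2 _ q0 m).
apply: (@le_trans _ _ (q 0 * A * (1 - e) ^+ m)).
  by rewrite -addn2; apply: le_trans_pow; rewrite ltW//= !ge_min lexx !orbT.
by rewrite -mulrA ler_wpM2l// hA.
Qed.

Lemma eventually_le_expr (A t : R) : 1 < t -> \forall n \near \oo, A <= t ^+ n.
Proof.
move=> t1; have : (fun n => t^-1 ^+ n) @ \oo --> (0 : R).
  apply: cvg_expr; rewrite ger0_norm ?invr_ge0; last by lra.
  by rewrite invf_lt1//; lra.
have A0 : 0 < (`|A| + 1)^-1 by rewrite invr_gt0 ltr_wpDl.
move=> /cvgrPdist_le/(_ _ A0); apply: filterS => n.
have tn : 0 < t ^+ n by rewrite exprn_gt0//; lra.
have A1 : 0 < `|A| + 1 by rewrite ltr_wpDl.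
rewrite sub0r normrN exprVn gtr0_norm ?invr_gt0// lef_pV2 ?posrE//.
by move=> h; apply: le_trans h; apply: le_trans (ler_norm A) _; rewrite lerDl.
Qed.

(** For e small, (1 - 2 e)^n <= u n <= (1 + 2 e)^n eventually, because the
    multiplicative constants are absorbed by ((1 + 2 e) / (1 + e))^n and
    ((1 - e) / (1 - 2 e))^n.  The bounds keep u nonnegative, so that the real
    power is a genuine root. *)
Lemma limn_esup_root u (p : R) : 0 < p -> slow_growth u -> slow_decay u ->
  limn_esup (fun n : nat => ((u n / p ^+ n) `^ (n%:R^-1))%:E) = (1 / p)%:E.
Proof.
move=> p0 up lo.
suff H : (fun n : nat => (u n / p ^+ n) `^ (n%:R^-1)) @ \oo --> 1 / p.
  have H' : (fun n : nat => ((u n / p ^+ n) `^ (n%:R^-1))%:E) @ \oo --> (1 / p)%:E.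
    by apply/fine_cvgP; split; [exact: nearW|exact: H].
  by have [_ ->] := cvg_limn_einf_sup H'.
apply/cvgrPdist_le => /= d d0.
pose e := Num.min (1 / 3) (p * d / 2).
have e0 : 0 < e by rewrite lt_min; apply/andP; split; [lra|rewrite divr_gt0// mulr_gt0].
have e3 : e <= 1 / 3 by rewrite ge_min lexx.
have epd : 2 * e <= p * d.
  have : e <= p * d / 2 by rewrite ge_min lexx orbT.
  lra.
have e01 : 0 < e < 1 by lra.
have [A A0 hA] := up _ e01; have [B B0 hB] := lo _ e01.
near=> n.
have n0 : (0 < n)%N by near: n; exact: nbhs_infty_gt.
have root_pow x : 0 <= x -> (x ^+ n) `^ (n%:R^-1) = x.
  move=> x0; rewrite -powR_mulrn// -powRrM mulfV ?powRr1//.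
  by rewrite pnatr_eq0 -lt0n.
have pn0 : 0 < p ^+ n by rewrite exprn_gt0.
have in0 : 0 <= n%:R^-1 :> R by rewrite invr_ge0.
have hi : (u n / p ^+ n) `^ (n%:R^-1) <= (1 + 2 * e) / p.
  have y0 : 0 <= (1 + 2 * e) / p by rewrite divr_ge0//; lra.
  rewrite -[leRHS]root_pow//; apply: ge0_ler_powR => //; rewrite ?nnegrE ?exprn_ge0//.
    rewrite divr_ge0 ?(ltW pn0)//; apply: le_trans (hB n).
    by rewrite mulr_ge0 ?exprn_ge0//; [exact: ltW|lra].
  rewrite expr_div_n ler_pM2r ?invr_gt0//; apply: le_trans (hA n) _.
  have en : 0 < (1 + e) ^+ n by rewrite exprn_gt0//; lra.
  rewrite -ler_pdivlMr// -expr_div_n; near: n; apply: eventually_le_expr.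
  by rewrite ltr_pdivlMr; lra.
have lw : (1 - 2 * e) / p <= (u n / p ^+ n) `^ (n%:R^-1).
  have y0 : 0 <= (1 - 2 * e) / p by rewrite divr_ge0//; lra.
  have en : 0 < (1 - 2 * e) ^+ n by rewrite exprn_gt0//; lra.
  have hBn : (1 - 2 * e) ^+ n <= u n.
    apply: le_trans (hB n).
    rewrite -ler_pdivrMl// -ler_pdivlMr// -expr_div_n.
    near: n; apply: eventually_le_expr.
    by rewrite ltr_pdivlMr; lra.
  rewrite -[leLHS]root_pow//; apply: ge0_ler_powR => //; rewrite ?nnegrE ?exprn_ge0//.
    by rewrite divr_ge0 ?(ltW pn0)//; apply: le_trans hBn; exact: ltW.
  by rewrite expr_div_n ler_pM2r ?invr_gt0.
rewrite ler_norml.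
have dp : 2 * e / p <= d by rewrite ler_pdivrMr// [d * p]mulrC.
move: hi lw; rewrite mulrDl mulrBl; lra.
Unshelve. all: by end_near. Qed.

End subexponential.

(** * Integrability and positivity *)

Section integration.
Context {R : realType}.
Local Notation mu := (@lebesgue_measure R).

(** The integrals over the exhausting segments are differences of values of F,
    so they stay bounded by 2 B. *)
Lemma integrable_bounded_primitive (f F : R -> R) (D : set R) (a b : nat -> R)
    (B : R) :
  (forall n, a n < b n) -> nonincreasing_seq a -> nondecreasing_seq b ->
  D = \bigcup_n `[a n, b n]%classic ->
  (forall x, D x -> 0 <= f x) -> (forall x, D x -> {for x, continuous f}) ->
  (forall x, D x -> is_derive x 1 F (f x)) -> (forall x, D x -> `|F x| <= B) ->
  mu.-integrable D (EFin \o f).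
Proof.
move=> ab na nb DE f0 cf dF FB.
have sub n : `[a n, b n]%classic `<=` D by rewrite DE => x abx; exists n.
have cfn n : {within `[a n, b n], continuous f}.
  by apply: continuous_in_subspaceT => x; rewrite inE => /sub; exact: cf.
have mfn n : measurable_fun `[a n, b n] f.
  exact: subspace_continuous_measurable_fun.
have mD : measurable D by rewrite DE; exact: bigcup_measurable.
have mf : measurable_fun D (EFin \o f).
  apply/measurable_EFinP; rewrite DE.
  by apply/measurable_fun_bigcup => // n; exact: mfn.
apply/integrableP; split => //.
under eq_integral => x xD.
  rewrite /= ger0_norm; last by apply: f0; rewrite inE in xD.
  over.
have In n : (\int[mu]_(x in `[a n, b n]) (f x)%:E <= (2 * B)%:E)%E.
  rewrite (@continuous_FTC2 _ f F)//.
  - have aD : D (a n) by apply: (sub n); rewrite /= in_itv/= lexx ltW.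
    have bD : D (b n) by apply: (sub n); rewrite /= in_itv/= lexx ltW.
    rewrite -EFinB lee_fin; have := FB _ aD; have := FB _ bD.
    by rewrite !ler_norml; lra.
  - have dc x : D x -> {for x, continuous F}.
      move=> Dx; apply/differentiable_continuous/derivable1_diffP.
      exact: (@ex_derive _ _ _ _ _ _ _ (dF x Dx)).
    split.
    + move=> x xab; apply: (@ex_derive _ _ _ _ _ _ _ (dF x _)).
      by apply: (sub n); exact: subset_itv_oo_cc.
    + by apply/cvg_at_right_filter/dc/(sub n); rewrite /= in_itv/= lexx ltW.
    + by apply/cvg_at_left_filter/dc/(sub n); rewrite /= in_itv/= lexx ltW.
  - move=> x xab; rewrite derive1E.
    apply: (@derive_val _ _ _ _ _ _ _ (dF x _)).
    by apply: (sub n); exact: subset_itv_oo_cc.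
apply: (@le_lt_trans _ _ (2 * B)%:E); last exact: ltry.
rewrite DE.
have H : (\int[mu]_(x in `[a i, b i]) (f x)%:E)%E @[i --> \oo] -->
   (\int[mu]_(x in \bigcup_i `[a i, b i]%classic) (f x)%:E)%E.
  apply: ge0_nondecreasing_set_cvg_integral => //.
  - move=> m n mn; rewrite subsetEset => x /=; rewrite !in_itv/= => /andP[ax xb].
    by rewrite (le_trans (na _ _ mn))// (le_trans xb)// nb.
  - by move=> n; apply/measurable_EFinP; exact: mfn.
  - by move=> n x /sub /f0; rewrite lee_fin.
rewrite -(cvg_lim _ H)//; apply: lime_le; first by apply/cvg_ex; eexists; exact: H.
exact: nearW.
Qed.

Lemma Rintegral_gt0 (D : set R) (f : R -> R) : measurable D -> (0 < mu D)%E ->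
  mu.-integrable D (EFin \o f) -> (forall x, D x -> 0 < f x) ->
  0 < \int[mu]_(x in D) f x.
Proof.
move=> mD muD fi f0.
rewrite lt_neqAle Rintegral_ge0 ?andbT; last by move=> x /f0/ltW.
apply/eqP => /esym I0.
have mf := measurable_int mu fi.
have : (\int[mu]_(x in D) `|(EFin \o f) x| = 0)%E.
  rewrite -[RHS]/(0%R%:E) -I0 fineK ?integrable_fin_num//.
  apply: eq_integral => x; rewrite inE => /f0 fx.
  by rewrite /= gtr0_norm.
move=> /ae_eq_integral_abs => /(_ mD mf)[N [mN N0 DN]].
have : (mu D <= 0)%E.
  rewrite -N0; apply: le_measure; rewrite ?inE// => x Dx; apply: DN => /= h.
  by have := f0 _ Dx; have := h Dx => /= -[] ->; rewrite ltxx.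
by rewrite leNgt muD.
Qed.

Lemma le_Rintegral_subset (A D : set R) (f : R -> R) :
  measurable A -> measurable D -> A `<=` D -> mu.-integrable D (EFin \o f) ->
  (forall x, D x -> 0 <= f x) ->
  \int[mu]_(x in A) f x <= \int[mu]_(x in D) f x.
Proof.
move=> mA mD AD fi f0; rewrite fine_le//.
- by apply: integrable_fin_num => //; exact: integrableS fi.
- exact: integrable_fin_num.
- by apply: ge0_subset_integral => //; exact: measurable_int fi.
Qed.

Lemma integrable_mul_bounded (D : set R) (h g : R -> R) (M : R) : measurable D ->
  measurable_fun D h -> (forall x, D x -> `|h x| <= M) ->
  mu.-integrable D (EFin \o g) -> mu.-integrable D (EFin \o (fun x => g x * h x)).
Proof.
move=> mD mh hM gi.
apply: (@le_integrable _ _ _ mu D mD _ (EFin \o (fun x => M * g x))).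
- have mg : measurable_fun D g by apply/measurable_EFinP; exact: measurable_int gi.
  by apply/measurable_EFinP; exact: measurable_funM.
- move=> x Dx; rewrite /= lee_fin !normrM mulrC ler_wpM2r//.
  by apply: le_trans (ler_norm M); exact: hM.
- rewrite (_ : _ \o _ = fun x => (M%:E * (EFin \o g) x)%E).
    exact: integrableZl.
  by apply/funext => x /=; rewrite EFinM.
Qed.

End integration.

(** * The Gamma integral and the logarithmic weight *)

Section gamma.
Context {R : realType}.
Local Notation mu := (@lebesgue_measure R).
Variable s : R.
Hypothesis s0 : 0 < s.

(** The derivative of the bounded function (t / (1 + t))^s, that is
    s t^(s-1) / (1 + t)^(s+1).  It has the same singularity at 0 as
    t^(s-1) exp (- t) and dominates it at infinity, so that one comparison
    covers all s > 0. *)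
Definition kern (t : R) := s * (t / (1 + t)) `^ (s - 1) / (1 + t) ^+ 2.
Definition kern_prim (t : R) := (t / (1 + t)) `^ s.

Lemma is_derive_frac (t : R) : 0 < t ->
  is_derive t (1 : R) (fun u : R => u / (1 + u)) ((1 + t) ^- 2).
Proof.
move=> t0; have t1 : 1 + t != 0 by lra.
have d0 : is_derive t (1 : R) (fun u : R => 1 + u) 1.
  by have := @is_deriveD _ _ _ (cst (1:R)) id t 1 0 1 _ _; rewrite add0r; apply.
have dV := @is_deriveV _ (fun u : R => 1 + u) t 1 1 t1 d0.
have h := @is_deriveM _ _ (@id R) (fun u : R => (1 + u)^-1) t 1 1 _ (is_derive_id _ _) dV.
rewrite (_ : (fun u : R => u / (1 + u)) = id * (fun u : R => (1 + u)^-1)); last by [].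
apply: (is_derive_eq h).
by rewrite /GRing.scale/=; field.
Qed.

Lemma is_derive_kern_prim (t : R) : 0 < t -> is_derive t (1 : R) kern_prim (kern t).
Proof.
move=> t0.
have p0 : 0 < t / (1 + t) by rewrite divr_gt0//; lra.
have := @is_derive1_comp _ (fun y => y `^ s) (fun t : R => t / (1 + t)) t _ _
  (is_derive1_powR s p0) (is_derive_frac _ t0).
by rewrite /kern_prim /kern /comp.
Qed.

Lemma kern_ge0 t : 0 <= t -> 0 <= kern t.
Proof.
by move=> t0; rewrite /kern divr_ge0 ?sqr_ge0// mulr_ge0 ?powR_ge0// ltW.
Qed.

Lemma kern_prim_le1 t : 0 <= t -> `|kern_prim t| <= 1.
Proof.
move=> t0; rewrite ger0_norm ?powR_ge0//.
have <- : 1 `^ s = 1 :> R by rewrite powR1.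
apply: ge0_ler_powR; rewrite ?nnegrE ?(ltW s0)//.
  by rewrite divr_ge0//; lra.
by rewrite ler_pdivrMr; lra.
Qed.

Lemma continuous_kern (t : R) : 0 < t -> {for t, continuous kern}.
Proof.
move=> t0; have t1 : 1 + t != 0 by lra.
have p0 : 0 < t / (1 + t) by rewrite divr_gt0//; lra.
have cp : {for t, continuous (fun u : R => u / (1 + u))}.
  by apply/differentiable_continuous/derivable1_diffP; case: (is_derive_frac _ t0).
have cq : {for t, continuous (fun u : R => (1 + u) ^- 2)}.
  apply: (@continuousV _ _ (fun u : R => (1 + u) ^+ 2)); first by rewrite expf_neq0.
  apply: (@continuous_comp _ _ _ (fun u : R => 1 + u) (fun y : R => y ^+ 2));
    last exact: exprn_continuous.
  by apply: cvgD; [exact: cvg_cst|exact: cvg_id].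
have cr : {for t, continuous (fun u : R => (u / (1 + u)) `^ (s - 1))}.
  apply: (@continuous_comp _ _ _ (fun u : R => u / (1 + u)) (fun y => y `^ (s - 1))) => //.
  apply/differentiable_continuous/derivable1_diffP.
  by apply: derivable_powR; rewrite in_itv/= andbT.
apply: cvgM; last exact: cq.
by apply: cvgM; [exact: cvg_cst|exact: cr].
Qed.

(** Amounts to (1 + t)^p <= A exp t with p = s + 1, which follows from
    v <= exp v at v = (1 + t) / p. *)
Lemma le_kern : exists2 A : R, 0 <= A & forall t, 0 < t ->
  t `^ (s - 1) * expR (- t) <= A * kern t.
Proof.
pose p := s + 1; have p0 : 0 < p by rewrite addr_gt0.
exists (p `^ p * expR 1 / s).
  by rewrite divr_ge0 ?(ltW s0)// mulr_ge0 ?powR_ge0 ?expR_ge0.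
move=> t t0; have t1 : 0 < 1 + t by lra.
have -> : t `^ (s - 1) = kern t / s * (1 + t) `^ p.
  have -> : (1 + t) `^ p = (1 + t) `^ (s - 1) * (1 + t) ^+ 2.
    rewrite -powR_mulrn ?(ltW t1)// -powRD; last by apply/implyP => _; rewrite gt_eqF.
    by congr (_ `^ _); rewrite /p; ring.
  have t1' : 1 + t != 0 by rewrite gt_eqF.
  have {1}-> : t = t / (1 + t) * (1 + t) by rewrite divfK.
  rewrite powRM ?(ltW t1)//; last by rewrite divr_ge0 ?ltW.
  by rewrite /kern; field; apply/andP; split => //; rewrite gt_eqF.
have H : (1 + t) `^ p * expR (- t) <= p `^ p * expR 1.
  have h : (1 + t) / p <= expR ((1 + t) / p).
    by apply: le_trans (expR_ge1Dx _); rewrite lerDr.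
  have h2 : (1 + t) `^ p <= p `^ p * expR (1 + t).
    have {1}-> : 1 + t = p * ((1 + t) / p) by rewrite mulrC divfK// gt_eqF.
    rewrite powRM ?(ltW p0)//; last by rewrite divr_ge0 ?ltW.
    rewrite ler_wpM2l ?powR_ge0//.
    have -> : expR (1 + t) = expR ((1 + t) / p) `^ p.
      by rewrite -expRM divfK// gt_eqF.
    by apply: ge0_ler_powR; rewrite ?nnegrE ?expR_ge0// ?ltW// divr_gt0.
  apply: le_trans (ler_wpM2r (expR_ge0 _) h2) _.
  by rewrite -mulrA -expRD addrK.
have k0 : 0 <= kern t / s by rewrite divr_ge0 ?kern_ge0 ?(ltW s0) ?(ltW t0).
have -> : p `^ p * expR 1 / s * kern t = kern t / s * (p `^ p * expR 1) by ring.
by rewrite -mulrA ler_wpM2l.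
Qed.

Lemma integrable_kern : mu.-integrable `]0, +oo[ (EFin \o kern).
Proof.
apply: (@integrable_bounded_primitive _ _ kern_prim _
  (fun n => n.+2%:R^-1) (fun n => n.+2%:R) 1).
- move=> n; apply: (@lt_trans _ _ 1); last by rewrite ltr1n.
  by rewrite invf_lt1// ltr1n.
- move=> m n mn; rewrite lef_pV2 ?posrE// ler_nat !ltnS//.
- by move=> m n mn; rewrite ler_nat !ltnS.
- apply/seteqP; split => x /=; rewrite in_itv/= ?andbT; last first.
    move=> [n _]; rewrite /= in_itv/= => /andP[+ _]; apply: lt_le_trans.
    by rewrite invr_gt0.
  move=> x0; exists (maxn (Num.bound x) (Num.bound x^-1)) => //=.
  have xb : x < (Num.bound x)%:R by apply: archi_boundP; exact: ltW.
  have xb' : x^-1 < (Num.bound x^-1)%:R by apply: archi_boundP; rewrite invr_ge0 ltW.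
  rewrite in_itv/=; apply/andP; split.
    rewrite invf_ple ?posrE//; apply: (le_trans (ltW xb')).
    by rewrite ler_nat (leq_trans (leq_maxr (Num.bound x) _))// ltnW.
  apply: (le_trans (ltW xb)).
  by rewrite ler_nat (leq_trans (leq_maxl _ (Num.bound x^-1)))// ltnW.
- by move=> x; rewrite /= in_itv/= andbT => /ltW; exact: kern_ge0.
- by move=> x; rewrite /= in_itv/= andbT; exact: continuous_kern.
- by move=> x; rewrite /= in_itv/= andbT; exact: is_derive_kern_prim.
- by move=> x; rewrite /= in_itv/= andbT => /ltW; exact: kern_prim_le1.
Qed.

Lemma measurable_gamma_integrand D :
  measurable_fun D (fun x : R => x `^ (s - 1) * expR (- x)).
Proof.
apply: measurable_funM.
  by apply: measurable_funTS; exact: measurable_powR.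
apply: measurable_funTS; apply: measurableT_comp; first exact: measurable_expR.
exact: measurable_funN.
Qed.

Lemma integrable_gamma :
  mu.-integrable `]0, +oo[ (EFin \o (fun x : R => x `^ (s - 1) * expR (- x))).
Proof.
have [A A0 hA] := le_kern.
apply: (@le_integrable _ _ _ mu _ _ _ (EFin \o (fun x => A * kern x))) => //.
- by apply/measurable_EFinP; exact: measurable_gamma_integrand.
- move=> x; rewrite /= in_itv/= andbT => x0; rewrite lee_fin.
  rewrite ger0_norm ?mulr_ge0 ?powR_ge0 ?expR_ge0//.
  by apply: le_trans (ler_norm _); exact: hA.
- rewrite (_ : _ \o _ = fun x => (A%:E * (EFin \o kern) x)%E).
    by apply: integrableZl => //; exact: integrable_kern.
  by apply/funext => x /=; rewrite EFinM.
Qed.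

Lemma Gamma_gt0 : 0 < Gamma s.
Proof.
apply: Rintegral_gt0 => //.
- by rewrite lebesgue_measure_itv/= ltry/= ltry.
- exact: integrable_gamma.
- by move=> x; rewrite /= in_itv/= andbT => x0; rewrite mulr_gt0 ?powR_gt0 ?expR_gt0.
Qed.

Definition weight (x : R) := (- ln x) `^ (s - 1).

Lemma oppr_ln_gt0 (x : R) : x \in `]0, 1[ -> 0 < - ln x.
Proof. by rewrite in_itv/= oppr_gt0 => /andP[x0 x1]; rewrite ln_lt0// x0. Qed.

Lemma weight_gt0 (x : R) : x \in `]0, 1[ -> 0 < weight x.
Proof. by move=> /oppr_ln_gt0 x01; rewrite powR_gt0. Qed.

Lemma measurable_weight D : measurable_fun D weight.
Proof.
apply: measurable_funTS.
apply: (@measurableT_comp _ _ _ _ _ _ (fun y : R => y `^ (s - 1)) _ (fun x => - ln x)).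
  exact: measurable_powR.
by apply: measurable_funN; exact: measurable_ln.
Qed.

Lemma continuous_oppr_ln (x : R) : 0 < x -> {for x, continuous (fun u : R => - ln u)}.
Proof. by move=> x0; apply: cvgN; exact: continuous_ln. Qed.

(** The substitution x = exp (- t) identifies this with the Gamma integral: for
    t = - ln x the bound [le_kern] reads weight x <= A * kern t / x, and
    kern (- ln x) / x has the primitive - kern_prim (- ln x). *)
Lemma integrable_weight : mu.-integrable `]0, 1[ (EFin \o weight).
Proof.
have [A A0 hA] := le_kern.
pose f x := kern (- ln x) / x.
have fi : mu.-integrable `]0, 1[ (EFin \o f).
  apply: (@integrable_bounded_primitive _ _ (fun x => - kern_prim (- ln x)) _
    (fun n => n.+3%:R^-1) (fun n => 1 - n.+3%:R^-1) 1).
  - move=> n /=; have : n.+3%:R^-1 < 2^-1 :> R; last by set y := _.+3%:R^-1; lra.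
    by rewrite ltf_pV2 ?posrE// ltr_nat.
  - by move=> m n mn; rewrite lef_pV2 ?posrE// ler_nat !ltnS.
  - by move=> m n mn; rewrite lerD2l lerN2 lef_pV2 ?posrE// ler_nat !ltnS.
  - apply/seteqP; split => x /=; rewrite in_itv/=; last first.
      move=> [n _]; rewrite /= in_itv/=.
      have : 0 < n.+3%:R^-1 :> R by rewrite invr_gt0.
      by set y := _.+3%:R^-1 => ? /andP[? ?]; apply/andP; split; lra.
    move=> /andP[x0 x1].
    have H (y : R) : 0 < y -> exists n, forall m, (n <= m)%N -> m.+3%:R^-1 <= y.
      move=> y0; exists (Num.bound y^-1) => m nm; rewrite invf_ple ?posrE//.
      have yb : y^-1 < (Num.bound y^-1)%:R.
        by apply: archi_boundP; rewrite invr_ge0 ltW.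
      by apply: (le_trans (ltW yb)); rewrite ler_nat (leq_trans nm)// -addn3 leq_addr.
    have [n1 h1] := H x x0.
    have [n2 h2] : exists n, forall m, (n <= m)%N -> m.+3%:R^-1 <= 1 - x by apply: H; lra.
    exists (maxn n1 n2) => //=; rewrite in_itv/= h1 ?leq_maxl//=.
    by have := h2 _ (leq_maxr n1 n2); set y := _.+3%:R^-1; lra.
  - move=> x /= /[dup] /oppr_ln_gt0 lx; rewrite in_itv/= => /andP[x0 _].
    by rewrite /f divr_ge0 ?(ltW x0)//; exact/kern_ge0/ltW.
  - move=> x /= /[dup] /oppr_ln_gt0 lx; rewrite in_itv/= => /andP[x0 _].
    apply: cvgM; last by apply: cvgV; [rewrite gt_eqF|exact: cvg_id].
    apply: (@continuous_comp _ _ _ (fun u : R => - ln u) kern).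
      exact: continuous_oppr_ln.
    exact: continuous_kern.
  - move=> x /= /[dup] /oppr_ln_gt0 lx; rewrite in_itv/= => /andP[x0 _].
    have d1 : is_derive x (1 : R) (fun u : R => - ln u) (- x^-1).
      by apply: is_deriveN; exact: is_derive1_ln.
    have d2 := @is_derive1_comp _ kern_prim (fun u : R => - ln u) x _ _
      (is_derive_kern_prim _ lx) d1.
    have d3 := is_deriveN d2.
    by apply: (is_derive_eq d3); rewrite mulrN opprK.
  - by move=> x /= /oppr_ln_gt0 lx; rewrite normrN; exact/kern_prim_le1/ltW.
apply: (@le_integrable _ _ _ mu _ _ _ (EFin \o (fun x => A * f x))) => //.
- by apply/measurable_EFinP; exact: measurable_weight.
- move=> x /= /[dup] x01 /[dup] /oppr_ln_gt0 lx; rewrite in_itv/= => /andP[x0 _].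
  rewrite lee_fin ger0_norm ?powR_ge0//; apply: le_trans (ler_norm _).
  rewrite /f mulrA ler_pdivlMr//; have := hA _ lx.
  by rewrite opprK lnK ?posrE.
- rewrite (_ : _ \o _ = fun x => (A%:E * (EFin \o f) x)%E).
    exact: integrableZl.
  by apply/funext => x /=; rewrite EFinM.
Qed.

End gamma.

(** * Moments of the weight and their gaps *)

Section moments.
Context {R : realType}.
Local Notation mu := (@lebesgue_measure R).
Local Notation C := R[i].
Variables s k : R.
Hypothesis s0 : 0 < s.
Hypothesis k02 : 0 < k <= 2.
Local Notation D := (`]0%R, 1%R[%classic : set R).
Local Notation wt := (weight s).

Definition node (x : R) := 1 - k * x ^+ 2.

Definition moment n := \int[mu]_(x in D) (wt x * node x ^+ n).

(** These are the numbers q_n: the differences of consecutive moments, divided by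
    the total mass. *)
Definition gap n := (moment n - moment n.+1) / moment 0.

Lemma k_gt0 : 0 < k. Proof. by case/andP: k02. Qed.

Lemma k_ge0 : 0 <= k. Proof. exact: ltW k_gt0. Qed.

Lemma unit_itv_lt x : D x -> 0 < x < 1.
Proof. by rewrite /= in_itv. Qed.

Lemma node_le1 x : D x -> `|node x| <= 1.
Proof.
move=> /unit_itv_lt /andP[x0 x1]; rewrite /node.
have x20 : 0 < x ^+ 2 by rewrite exprn_gt0.
have x21 : x ^+ 2 < 1 by rewrite expr_lt1// ltW.
have /andP[k0 k2] := k02.
have kx0 : 0 <= k * x ^+ 2 by rewrite mulr_ge0// ltW.
have kx2 : k * x ^+ 2 <= 2 * 1 by apply: ler_pM => //; exact: ltW.
by rewrite ler_norml; lra.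
Qed.

Lemma measurable_node A : measurable_fun A node.
Proof.
apply: measurable_funB; first exact: measurable_cst.
by apply: measurable_funM; [exact: measurable_cst|exact: exprn_measurable].
Qed.

Lemma node_pow_le1 x n : D x -> `|node x ^+ n| <= 1.
Proof. by move=> Dx; rewrite normrX exprn_ile1// node_le1. Qed.

Lemma integrable_weightM (h : R -> R) M : measurable_fun D h ->
  (forall x, D x -> `|h x| <= M) -> mu.-integrable D (EFin \o (fun x => wt x * h x)).
Proof.
move=> mh hM; apply: (@integrable_mul_bounded _ _ h wt M) => //.
exact: integrable_weight.
Qed.

Lemma measurable_node_pow n A : measurable_fun A (fun x => node x ^+ n).
Proof. by apply: measurable_funX; exact: measurable_node. Qed.

Lemma integrable_moment n :
  mu.-integrable D (EFin \o (fun x => wt x * node x ^+ n)).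
Proof.
apply: (integrable_weightM _ 1); first exact: measurable_node_pow.
by move=> x; exact: node_pow_le1.
Qed.

Lemma mu_unit_itv : (0 < mu D)%E.
Proof. by rewrite lebesgue_measure_itv/= lte_fin ltr01 -EFinB lte_fin subr0. Qed.

Lemma wt_gt0 x : D x -> 0 < wt x.
Proof. by move=> Dx; apply: weight_gt0. Qed.

Lemma moment0_gt0 : 0 < moment 0.
Proof.
apply: Rintegral_gt0 => //; [exact: mu_unit_itv|exact: integrable_moment|].
by move=> x Dx; rewrite expr0 mulr1 wt_gt0.
Qed.

Lemma moment_diff n : moment n - moment n.+1 =
  \int[mu]_(x in D) (wt x * (k * x ^+ 2 * node x ^+ n)).
Proof.
rewrite /moment -RintegralB//; [|exact: integrable_moment|exact: integrable_moment].
by apply: eq_Rintegral => x _; rewrite exprS /node; ring.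
Qed.

Lemma integrable_moment_diff n :
  mu.-integrable D (EFin \o (fun x => wt x * (k * x ^+ 2 * node x ^+ n))).
Proof.
apply: (integrable_weightM _ 2).
  apply: measurable_funM; last exact: measurable_node_pow.
  by apply: measurable_funM; [exact: measurable_cst|exact: exprn_measurable].
move=> x Dx; have /andP[x0 x1] := unit_itv_lt _ Dx.
have x20 : 0 < x ^+ 2 by rewrite exprn_gt0.
have x21 : x ^+ 2 < 1 by rewrite expr_lt1// ltW.
rewrite normrM -[2]mulr1 ler_pM//; last exact: node_pow_le1.
have /andP[k0 k2] := k02.
rewrite ger0_norm; last by rewrite mulr_ge0// ltW.
by rewrite -[leRHS]mulr1; apply: ler_pM => //; exact: ltW.
Qed.

Lemma gap_even_ge0 n : ~~ odd n -> 0 <= gap n.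
Proof.
move=> en; rewrite divr_ge0 ?(ltW moment0_gt0)// moment_diff.
apply: Rintegral_ge0 => x Dx.
rewrite mulr_ge0 ?(ltW (wt_gt0 _ Dx))//.
by rewrite mulr_ge0 ?exprn_even_ge0// mulr_ge0 ?sqr_ge0 ?k_ge0.
Qed.

Lemma sum_gap N : \sum_(n < N) gap n = 1 - moment N / moment 0.
Proof.
have Z0 : moment 0 != 0 by rewrite gt_eqF// moment0_gt0.
elim: N => [|N IH]; first by rewrite big_ord0 divff// subrr.
by rewrite big_ord_recr/= IH /gap; field.
Qed.

(** An even moment is nonnegative for its integrand is; an odd one is at least the
    next one, which is even. *)
Lemma moment_ge0 N : (forall n, 0 <= gap n) -> 0 <= moment N.
Proof.
move=> g0; have even_ge0 n : ~~ odd n -> 0 <= moment n.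
  move=> en; apply: Rintegral_ge0 => x Dx.
  by rewrite mulr_ge0 ?(ltW (wt_gt0 _ Dx))// exprn_even_ge0.
have [oN|] := boolP (odd N); last exact: even_ge0.
have := g0 N; rewrite /gap pmulr_lge0 ?invr_gt0 ?moment0_gt0// subr_ge0.
by apply: le_trans; apply: even_ge0; rewrite /= oN.
Qed.

Lemma sum_gap_le1 N : (forall n, 0 <= gap n) -> \sum_(n < N) gap n <= 1.
Proof.
by move=> g0; rewrite sum_gap gerBl divr_ge0 ?moment_ge0.
Qed.

(** On ]0, e/2[ the node is at least 1 - e, because k (e/2)^2 <= e. *)
Lemma gap_even_decay (e : R) : 0 < e < 1 -> exists2 A, 0 < A &
  forall n, ~~ odd n -> A * (1 - e) ^+ n <= gap n.
Proof.
move=> /andP[e0 e1]; pose E := (`]0%R, (e / 2)%R[%classic : set R).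
have mE : measurable E by exact: measurable_itv.
have ED : E `<=` D.
  by move=> x; rewrite /E /= !in_itv/= => /andP[-> ?]; lra.
pose f x := wt x * (k * x ^+ 2).
have fi : mu.-integrable D (EFin \o f).
  have := integrable_moment_diff 0; congr (mu.-integrable D _).
  by apply/funext => x /=; rewrite /f expr0 mulr1.
have f0 x : D x -> 0 < f x.
  move=> Dx; have /andP[x0 _] := unit_itv_lt _ Dx.
  by rewrite mulr_gt0 ?wt_gt0// mulr_gt0 ?exprn_gt0// k_gt0.
have fiE : mu.-integrable E (EFin \o f) by apply: (@integrableS _ _ _ mu D E).
have IE : 0 < \int[mu]_(x in E) f x.
  apply: Rintegral_gt0 => //; last by move=> x /ED; exact: f0.
  by rewrite /E lebesgue_measure_itv/= lte_fin divr_gt0// -EFinB lte_fin subr0 divr_gt0.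
exists ((\int[mu]_(x in E) f x) / moment 0) => [|n en].
  by rewrite divr_gt0// moment0_gt0.
rewrite mulrAC ler_wpM2r ?invr_ge0 ?(ltW moment0_gt0)// moment_diff.
apply: (@le_trans _ _ (\int[mu]_(x in E) (wt x * (k * x ^+ 2 * node x ^+ n)))).
  rewrite -RintegralZr//; apply: le_Rintegral => //.
  - rewrite (_ : _ \o _ = fun x => ((EFin \o f) x * ((1 - e) ^+ n)%:E)%E).
      by apply: integrableZr.
    by apply/funext => x /=; rewrite EFinM.
  - by apply: (@integrableS _ _ _ mu D E) => //; exact: integrable_moment_diff.
  - move=> x Ex; rewrite /f [leRHS]mulrA.
    rewrite ler_wpM2l ?(ltW (f0 _ (ED _ Ex)))//.
    move: Ex; rewrite /E /= in_itv/= => /andP[x0 xe].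
    apply: ler_pow_base; apply/andP; split; first lra.
    rewrite /node; have : x ^+ 2 <= (e / 2) ^+ 2 by apply: ler_pow_base; apply/andP; split; lra.
    have /andP[_ k2] := k02; have x2 := sqr_ge0 x.
    have kx2 : k * x ^+ 2 <= 2 * x ^+ 2 by rewrite ler_wpM2r.
    have e2 : e ^+ 2 <= e by rewrite expr2 ler_piMl// ltW.
    by rewrite expr_div_n; lra.
apply: le_Rintegral_subset => //; first exact: integrable_moment_diff.
move=> x Dx; rewrite mulr_ge0 ?(ltW (wt_gt0 _ Dx))//.
by rewrite mulr_ge0 ?exprn_even_ge0// mulr_ge0 ?sqr_ge0 ?k_ge0.
Qed.

End moments.

(** For k <= 1 the node itself is nonnegative. *)
Lemma gap_ge0_of_le1 {R : realType} (s k : R) n : 0 < s -> 0 < k <= 1 -> 0 <= gap s k n.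
Proof.
move=> s0 /andP[k0 k1]; have k02 : 0 < k <= 2 by rewrite k0 (le_trans k1)// ler1n.
rewrite /gap divr_ge0 ?(ltW (moment0_gt0 _ _ s0 k02))// (moment_diff _ _ s0 k02).
apply: Rintegral_ge0 => x Dx; have /andP[x0 x1] := unit_itv_lt _ Dx.
have x2 : x ^+ 2 <= 1 by rewrite expr_le1// ltW.
apply: mulr_ge0; first exact: ltW (wt_gt0 s _ Dx).
apply: mulr_ge0; first by rewrite mulr_ge0 ?sqr_ge0 ?(ltW k0).
rewrite exprn_ge0// /node subr_ge0.
by rewrite -[leRHS]mulr1 ler_pM ?sqr_ge0// ltW.
Qed.

(** * Nonnegativity of the odd gaps for k = 2 *)

Section symmetry.
Context {R : realType}.
Local Notation mu := (@lebesgue_measure R).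
Local Notation D := (`]0%R, 1%R[%classic : set R).

(** Concavity of ln between p and 1, at the point
    q = (p / q) p + (1 - p / q) 1, where p + q = 1 is used. *)
Lemma xlnx_le (p q : R) : 0 < p -> p <= q -> p + q = 1 -> q * - ln q <= p * - ln p.
Proof.
move=> p0 pq pq1; have q0 : 0 < q by lra.
have pq0 : 0 <= p / q by rewrite divr_ge0// ltW.
have pq11 : p / q <= 1 by rewrite ler_pdivrMr// mul1r.
have := @concave_ln _ (Itv01 pq0 pq11) p 1 p0 ltr01.
rewrite !convRE/= ln1 mulr0 addr0.
rewrite (_ : p / q * p + _ * 1 = q); last first.
  have p1 : p = 1 - q by lra.
  by rewrite p1 /unstable.onem; field; rewrite gt_eqF.
move=> h; have := ler_wpM2l (ltW q0) h.
rewrite mulrA [q * (p / q)]mulrC divfK ?gt_eqF// !mulrN lerN2.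
by [].
Qed.

(** The involution of ]0, 1[ that sends [node 2 x] to its opposite. *)
Definition refl_node (x : R) := Num.sqrt (1 - x ^+ 2).

(** [xlnx_le] at p = x^2, divided by the larger of the two numbers. *)
Lemma xlnx_refl_node_le (x : R) : 0 < x -> x <= refl_node x -> x < 1 ->
  refl_node x * - ln (refl_node x) <= x * - ln x.
Proof.
move=> x0 xx' x1; set y := refl_node x in xx' *.
have y0 : 0 < y by exact: lt_le_trans xx'.
have x2 : x ^+ 2 < 1 by rewrite expr_lt1// ltW.
have y2 : y ^+ 2 = 1 - x ^+ 2 by rewrite sqr_sqrtr; lra.
have := @xlnx_le (x ^+ 2) (y ^+ 2).
rewrite exprn_gt0// !lnXn// => /(_ isT) h.
have {}h : y * (y * - ln y) <= x * (x * - ln x).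
  have : x ^+ 2 <= y ^+ 2 by apply: ler_pow_base; rewrite xx' ltW.
  move=> /h; rewrite y2 => /(_ ltac:(lra)).
  rewrite -y2 !expr2 !mulr2n; set u := ln x; set v := ln y; nra.
have lx : 0 <= x * - ln x.
  by rewrite mulr_ge0 ?(ltW x0)// oppr_ge0 ln_le0// ltW.
have := ler_wpM2r lx xx'.
by move=> /(le_trans h); rewrite ler_pM2l.
Qed.

Variable s : R.
Hypothesis hs : 2 <= s.
Local Notation wt := (weight s).

Let s0 : 0 < s.
Proof. exact: lt_le_trans hs. Qed.

(** One factor - ln is used for [xlnx_refl_node_le]; the remaining power s - 2 is
    nonnegative, hence monotone. *)
Lemma weight_refl_node_le (x : R) : 0 < x -> x <= refl_node x -> refl_node x < 1 ->
  refl_node x * wt (refl_node x) <= x * wt x.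
Proof.
move=> x0 xx' y1; have x1 : x < 1 by exact: le_lt_trans y1.
have H := xlnx_refl_node_le _ x0 xx' x1.
set y := refl_node x in xx' y1 H *.
have y0 : 0 < y by exact: lt_le_trans xx'.
have ly : 0 < - ln y by rewrite oppr_gt0 ln_lt0// y0.
have lx : 0 < - ln x by rewrite oppr_gt0 ln_lt0// x0.
have lyx : - ln y <= - ln x by rewrite lerN2 ler_ln.
have s1 : 0 < s - 1 by have := hs; lra.
have E z : 0 < z -> z `^ (s - 1) = z * z `^ (s - 1 - 1).
  by move=> z0; rewrite mulr_powRB1// ltW.
rewrite /weight (E _ ly) (E _ lx) !mulrA.
apply: ler_pM => //; first by rewrite mulr_ge0// ltW.
  exact: powR_ge0.
by apply: ge0_ler_powR; rewrite ?nnegrE ?(ltW lx) ?(ltW ly)//; have := hs; lra.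
Qed.

Lemma measurable_inv_nonneg (A : set R) (f : R -> R) : measurable_fun A f ->
  (forall x, A x -> 0 <= f x) -> measurable_fun A (fun x => (f x)^-1).
Proof.
move=> mf f0; apply: (@eq_measurable_fun _ _ _ _ _ (fun x => f x `^ (-1))).
  by move=> x; rewrite inE => /f0 fx; rewrite powR_inv1.
exact: (@measurableT_comp _ _ _ _ _ _ (fun y : R => y `^ (-1)) _ f).
Qed.

(** The fixed point of the reflection. *)
Let c : R := Num.sqrt 2^-1.

Let c0 : 0 < c. Proof. by rewrite sqrtr_gt0 invr_gt0. Qed.

Let c2 : c ^+ 2 = 2^-1. Proof. by rewrite sqr_sqrtr// invr_ge0. Qed.

Let c1 : c < 1.
Proof. by rewrite -(@ltr_pXn2r _ 2) ?nnegrE ?(ltW c0)// c2 expr1n invf_lt1// ltr1n. Qed.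

Lemma refl_node_c : refl_node c = c.
Proof. by rewrite /refl_node c2; congr Num.sqrt; lra. Qed.

Lemma refl_node0 : refl_node 0 = 1.
Proof. by rewrite /refl_node expr0n subr0 sqrtr1. Qed.

Lemma is_derive_refl_node (x : R) : -1 < x < 1 ->
  is_derive x (1 : R) refl_node (- (x / refl_node x)).
Proof.
move=> /andP[x0 x1].
have x2 : 0 < 1 - x ^+ 2.
  by rewrite subr_gt0 -real_normK ?num_real// expr_lt1// ltr_norml x0.
have d1 : is_derive x (1 : R) (fun u : R => 1 - u ^+ 2) (- (2 * x)).
  have h := @is_deriveB _ _ _ (cst (1:R)) (fun u : R => u ^+ 2) x 1 _ _
    (is_derive_cst _ _ _) (@is_deriveX _ _ _ 2 x 1 1 (is_derive_id _ _)).
  by apply: (is_derive_eq h); rewrite /GRing.scale/= sub0r mulr1.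
have h := @is_derive1_comp _ Num.sqrt (fun u : R => 1 - u ^+ 2) x _ _
  (is_derive1_sqrt x2) d1.
apply: (is_derive_eq h); rewrite -/(refl_node x).
have y0 : refl_node x != 0 by rewrite gt_eqF// sqrtr_gt0.
by field.
Qed.

Lemma refl_node_gt0 (x : R) : -1 < x < 1 -> 0 < refl_node x.
Proof.
move=> /andP[x0 x1]; rewrite sqrtr_gt0 subr_gt0 -real_normK ?num_real//.
by rewrite expr_lt1// ltr_norml x0.
Qed.

Lemma sqr_refl_node (x : R) : -1 < x < 1 -> refl_node x ^+ 2 = 1 - x ^+ 2.
Proof.
move=> x11; apply: sqr_sqrtr; apply: ltW; rewrite -sqrtr_gt0.
exact: refl_node_gt0.
Qed.

Lemma derive1_refl_node (x : R) : -1 < x < 1 ->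
  refl_node^`()%classic x = - (x / refl_node x).
Proof.
by move=> x11; rewrite derive1E; apply: derive_val; exact: is_derive_refl_node.
Qed.

Lemma continuous_refl_node (x : R) : -1 < x < 1 -> {for x, continuous refl_node}.
Proof.
move=> /is_derive_refl_node d.
by apply/differentiable_continuous/derivable1_diffP; case: d.
Qed.

Lemma continuous_derive1_refl_node (x : R) : -1 < x < 1 ->
  {for x, continuous (refl_node^`()%classic)}.
Proof.
move=> x11; rewrite /prop_for /continuous_at derive1_refl_node//.
have H : (- (u / refl_node u)) @[u --> x] --> - (x / refl_node x).
  apply: cvgN; apply: cvgM; first exact: cvg_id.
  by apply: cvgV; [rewrite gt_eqF// refl_node_gt0|exact: continuous_refl_node].
apply: cvg_trans H; apply: near_eq_cvg; near=> u.
rewrite derive1_refl_node//; apply/andP; split; near: u.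
  by apply: lt_nbhsr; case/andP: x11.
by apply: lt_nbhsl; case/andP: x11.
Unshelve. all: by end_near. Qed.

Variable n : nat.
Hypothesis oddn : odd n.

(** The integrand of the gap of odd index n: nonnegative before c and nonpositive
    after it. *)
Let h (x : R) := wt x * (2 * x ^+ 2 * node 2 x ^+ n).

Let continuous_poly (x : R) : {for x, continuous (fun u : R => 2 * u ^+ 2 * node 2 u ^+ n)}.
Proof.
have cX m : {for x, continuous (fun u : R => u ^+ m)} by exact: exprn_continuous.
apply: cvgM; first by apply: cvgM; [exact: cvg_cst|exact: cX].
apply: (@continuous_comp _ _ _ (node 2) (fun y : R => y ^+ n)); last exact: exprn_continuous.
apply: cvgB; first exact: cvg_cst.
by apply: cvgM; [exact: cvg_cst|exact: cX].
Qed.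

Let continuous_h (x : R) : 0 < x < 1 -> {for x, continuous h}.
Proof.
move=> /andP[x0 x1]; apply: cvgM; last exact: continuous_poly.
apply: (@continuous_comp _ _ _ (fun u : R => - ln u) (fun y : R => y `^ (s - 1))).
  exact: continuous_oppr_ln.
apply/differentiable_continuous/derivable1_diffP.
by apply: derivable_powR; rewrite in_itv/= andbT oppr_gt0 ln_lt0// x0.
Qed.

Let h1 : h 1 = 0.
Proof.
have s1 : 0 < s - 1 by have := hs; lra.
by rewrite /h /weight ln1 oppr0 powR0 ?mul0r// gt_eqF.
Qed.

(** Since s - 1 >= 1, the weight is at most - ln x near 1. *)
Let continuous_h1 : h x @[x --> 1^'-] --> h 1.
Proof.
have -> : h 1 = 0 * (2 * 1 ^+ 2 * node 2 1 ^+ n) by rewrite h1 mul0r.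
apply: cvgM; last exact/cvg_at_left_filter/continuous_poly.
apply: (@squeeze_cvgr _ _ _ _ (cst 0) (fun x => - ln x)); last 2 first.
- exact: cvg_cst.
- apply: cvg_at_left_filter; have := @continuous_oppr_ln R 1 ltr01.
  by rewrite /prop_for /continuous_at ln1 oppr0.
near=> x; rewrite powR_ge0/=; apply: ge1r_powR; last by have := hs; lra.
have x1 : x < 1 by near: x; exact: nbhs_left_lt.
have xe : expR (- 1) < x.
  by near: x; apply: nbhs_left_gt; rewrite -[ltRHS]expR0 ltr_expR oppr_lt0.
have x0 : 0 < x by apply: le_lt_trans xe; exact: expR_ge0.
rewrite oppr_gt0 ln_lt0 ?x0//= lerNl -(expRK (-1)) ler_ln ?posrE ?expR_gt0//.
exact: ltW.
Unshelve. all: by end_near. Qed.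

Let within_h : {within `[c, 1], continuous h}.
Proof.
apply/(continuous_within_itvP _ c1); split; last exact: continuous_h1.
  move=> x; rewrite in_itv/= => /andP[cx x1]; apply: continuous_h.
  by rewrite x1 (lt_trans c0).
by apply/cvg_at_right_filter/continuous_h; rewrite c0 c1.
Qed.

Let itv0c x : x \in `[0, c] -> -1 < x < 1.
Proof. by rewrite in_itv/= => /andP[x0 xc]; have := c1; lra. Qed.

Lemma measurable_refl_node A : measurable_fun A refl_node.
Proof.
apply: measurable_funTS; apply: continuous_measurable_fun => x.
apply: (@continuous_comp _ _ _ (fun u : R => 1 - u ^+ 2) (@Num.sqrt R)).
  by apply: cvgB; [exact: cvg_cst|exact: exprn_continuous].
exact: sqrt_continuous.
Qed.

Let measurable_h A : measurable_fun A h.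
Proof.
apply: measurable_funTS; apply: measurable_funM; first exact: measurable_weight.
by apply: continuous_measurable_fun => x; exact: continuous_poly.
Qed.

Let refl_integrand (x : R) := h (refl_node x) * (x / refl_node x).

Let measurable_refl_integrand A : measurable_fun A refl_integrand.
Proof.
apply: measurable_funTS; apply: measurable_funM.
  apply: (@measurableT_comp _ _ _ _ _ _ h _ refl_node) => //.
  exact: measurable_refl_node.
apply: measurable_funM => //; apply: measurable_inv_nonneg.
  exact: measurable_refl_node.
by move=> x _; exact: sqrtr_ge0.
Qed.

(** Folds the part beyond c, on which h is nonpositive, onto ]0, c[. *)
Lemma refl_node_substitution :
  (\int[mu]_(x in `[c, 1%R]) (h x)%:E =
   \int[mu]_(x in `]0%R, c[) (refl_integrand x)%:E)%E.
Proof.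
have := @integration_by_substitution_decreasing R refl_node h 0 c (ltW c0).
rewrite refl_node0 refl_node_c => ->.
- rewrite -(@integral_itv_bndoo _ 0 c _ true false).
    apply: eq_integral => x; rewrite inE /= => x0c.
    by rewrite fctE /= fctE derive1_refl_node ?opprK// itv0c.
  by apply/measurable_EFinP; exact: measurable_refl_integrand.
- move=> x y x0c y0c xy; rewrite ltr_sqrt.
    rewrite ltrD2l ltrN2; move: x0c y0c; rewrite !in_itv/=.
    by move=> /andP[x0 _] /andP[y0 _]; rewrite ltr_pXn2r.
  by rewrite -sqrtr_gt0 refl_node_gt0// itv0c.
- move=> x x0c; apply: continuous_derive1_refl_node; apply: itv0c; exact: subset_itv_oo_cc.
- apply/cvg_ex; eexists; apply: cvg_at_right_filter.
  apply: continuous_derive1_refl_node; apply: itv0c; by rewrite in_itv/= lexx ltW.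
- apply/cvg_ex; eexists; apply: cvg_at_left_filter.
  apply: continuous_derive1_refl_node; apply: itv0c; by rewrite in_itv/= lexx ltW.
- split.
  + move=> x x0c; apply: (@ex_derive _ _ _ _ _ _ _ (is_derive_refl_node _ _)).
    by apply: itv0c; exact: subset_itv_oo_cc.
  + apply/cvg_at_right_filter/continuous_refl_node/itv0c.
    by rewrite in_itv/= lexx ltW.
  + apply/cvg_at_left_filter/continuous_refl_node/itv0c.
    by rewrite in_itv/= lexx ltW.
- exact: within_h.
Qed.

Let refl_integrand_bounds (x : R) : `]0, c[%classic x ->
  - h x <= refl_integrand x <= 0.
Proof.
rewrite /= in_itv/= => /andP[x0 xc].
have x11 : -1 < x < 1 by have := c1; lra.
have x2c : x ^+ 2 <= 2^-1 by rewrite -c2; apply: ler_pow_base; apply/andP; split; lra.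
have y2 := sqr_refl_node _ x11; have y0 := refl_node_gt0 _ x11.
have x20 : 0 < x ^+ 2 by rewrite exprn_gt0.
have xy : x <= refl_node x.
  by rewrite -(@ler_pXn2r _ 2) ?nnegrE ?(ltW x0) ?(ltW y0)// y2; lra.
have y1 : refl_node x < 1.
  by rewrite -(@ltr_pXn2r _ 2) ?nnegrE ?(ltW y0)// y2 expr1n; lra.
have nodeN : node 2 (refl_node x) = - node 2 x by rewrite /node y2; ring.
have -> : refl_integrand x =
    - (2 * x * node 2 x ^+ n * (refl_node x * wt (refl_node x))).
  rewrite /refl_integrand /h nodeN exprNn -signr_odd oddn expr1.
  have yn0 : refl_node x != 0 by rewrite gt_eqF.
  by field.
have -> : h x = 2 * x * node 2 x ^+ n * (x * wt x) by rewrite /h; ring.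
have P : 0 <= 2 * x * node 2 x ^+ n.
  by rewrite mulr_ge0 ?exprn_ge0// /node; lra.
rewrite lerN2 ler_wpM2l ?weight_refl_node_le//= oppr_le0 mulr_ge0//.
by rewrite mulr_ge0 ?powR_ge0// ltW.
Qed.

Lemma gap_odd_ge0 : 0 <= gap s 2 n.
Proof.
have k2 : 0 < (2 : R) <= 2 by rewrite ltr0n lexx.
rewrite /gap divr_ge0 ?(ltW (moment0_gt0 _ _ s0 k2))//.
rewrite (moment_diff _ _ s0 k2).
have hi : mu.-integrable D (EFin \o h) by exact: integrable_moment_diff.
rewrite -/h.
have sub0c : `]0, c[%classic `<=` D.
  by move=> x; rewrite /= !in_itv/= => /andP[-> /lt_trans->].
have hi0c : mu.-integrable `]0, c[ (EFin \o h).
  exact: (@integrableS _ _ _ mu D).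
have ri : mu.-integrable `]0, c[ (EFin \o refl_integrand).
  apply: (@le_integrable _ _ _ mu _ _ _ (EFin \o h)) => //.
    by apply/measurable_EFinP; exact: measurable_refl_integrand.
  move=> x x0c; have /andP[h1' h2'] := refl_integrand_bounds _ x0c.
  rewrite /= lee_fin (ler0_norm h2'); apply: le_trans (ler_norm _).
  by rewrite lerNl.
have split_int := @Rintegral_itvB _ h (BRight 0) (BLeft 1) c hi.
have e1 : \int[mu]_(x in `]0, c]) h x = \int[mu]_(x in `]0, c[) h x.
  by rewrite -Rintegral_itv_bndo_bndc.
have e2 : \int[mu]_(x in `]c, 1[) h x = \int[mu]_(x in `]0, c[) refl_integrand x.
  rewrite /Rintegral -refl_node_substitution (@integral_itv_bndoo _ c 1 _ true false)//.
  by apply/measurable_EFinP; exact: measurable_h.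
have -> : \int[mu]_(x in D) h x =
    \int[mu]_(x in `]0, c[) h x + \int[mu]_(x in `]0, c[) refl_integrand x.
  rewrite -e1 -e2 -split_int; first by rewrite addrC subrK.
    by rewrite bnd_simp ltW.
  by rewrite bnd_simp.
rewrite -RintegralD//; apply: Rintegral_ge0 => x /refl_integrand_bounds.
by move=> /andP[? _]; rewrite -lerBlDl sub0r.
Qed.

End symmetry.

(** * Expansion of the generating functions *)

Section generating_function.
Context {R : realType}.
Local Notation mu := (@lebesgue_measure R).
Local Notation C := R[i].
Local Notation D := (`]0%R, 1%R[%classic : set R).

Lemma complexRe_inv (z : C) : complex.Re z^-1 =
  complex.Re z / (complex.Re z ^+ 2 + complex.Im z ^+ 2).
Proof. by case: z. Qed.

Lemma complexIm_inv (z : C) : complex.Im z^-1 =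
  - (complex.Im z / (complex.Re z ^+ 2 + complex.Im z ^+ 2)).
Proof. by case: z. Qed.

Lemma ReM_real (x : R) (z : C) : complex.Re (x%:C%C * z) = x * complex.Re z.
Proof. by case: z => a b /=; rewrite mul0r subr0. Qed.

Lemma ImM_real (x : R) (z : C) : complex.Im (x%:C%C * z) = x * complex.Im z.
Proof. by case: z => a b /=; rewrite mul0r addr0. Qed.

Lemma ReB (z z' : C) : complex.Re (z - z') = complex.Re z - complex.Re z'.
Proof. by case: z z' => ? ? []. Qed.

Lemma ImB (z z' : C) : complex.Im (z - z') = complex.Im z - complex.Im z'.
Proof. by case: z z' => ? ? []. Qed.

Lemma Re_psum (a : nat -> R) (w : C) N :
  complex.Re (psum a w N) = \sum_(n < N) a n * complex.Re (w ^+ n).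
Proof.
elim: N => [|N IH]; first by rewrite /psum !big_ord0.
rewrite psumS big_ord_recr /= -IH -ReM_real.
by case: (psum a w N) ((a N)%:C%C * w ^+ N) => ? ? [].
Qed.

Lemma Im_psum (a : nat -> R) (w : C) N :
  complex.Im (psum a w N) = \sum_(n < N) a n * complex.Im (w ^+ n).
Proof.
elim: N => [|N IH]; first by rewrite /psum !big_ord0.
rewrite psumS big_ord_recr /= -IH -ImM_real.
by case: (psum a w N) ((a N)%:C%C * w ^+ N) => ? ? [].
Qed.

Lemma measurable_sqr_affine (a b : R) A :
  measurable_fun A (fun x : R => a + b * x ^+ 2).
Proof.
apply: measurable_funD; first exact: measurable_cst.
by apply: measurable_funM; [exact: measurable_cst|exact: exprn_measurable].
Qed.

Section kernel.
Variable t : C.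
Let den (x : R) : C := 1 + t * (x ^+ 2)%:C%C.

Let Re_den x : complex.Re (den x) = 1 + complex.Re t * x ^+ 2.
Proof. by rewrite /den; case: t => a b /=; rewrite mulr0 subr0. Qed.

Let Im_den x : complex.Im (den x) = 0 + complex.Im t * x ^+ 2.
Proof. by rewrite /den; case: t => a b /=; rewrite mulr0 add0r. Qed.

Let measurable_den2 A : measurable_fun A
  (fun x : R => (complex.Re (den x) ^+ 2 + complex.Im (den x) ^+ 2)^-1).
Proof.
apply: measurable_inv_nonneg; last by move=> x _; rewrite addr_ge0// sqr_ge0.
under eq_fun do rewrite Re_den Im_den.
by apply: measurable_funD; apply: measurable_funX; exact: measurable_sqr_affine.
Qed.

Lemma measurable_Re_kernel A :
  measurable_fun A (fun x : R => complex.Re (1 + t * (x ^+ 2)%:C%C)^-1).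
Proof.
under eq_fun do rewrite complexRe_inv.
apply: measurable_funM; last exact: measurable_den2.
by under eq_fun do rewrite -/(den _) Re_den; exact: measurable_sqr_affine.
Qed.

Lemma measurable_Im_kernel A :
  measurable_fun A (fun x : R => complex.Im (1 + t * (x ^+ 2)%:C%C)^-1).
Proof.
under eq_fun do rewrite complexIm_inv.
apply: measurable_funN; apply: measurable_funM; last exact: measurable_den2.
by under eq_fun do rewrite -/(den _) Im_den; exact: measurable_sqr_affine.
Qed.

End kernel.

(** Coefficients in w of (1 - w) / (1 - w y). *)
Definition node_coef (y : R) n := if n is m.+1 then - ((1 - y) * y ^+ m) else 1.

Lemma psum_node_coef (y : R) (w : C) N : 1 - w * y%:C%C != 0 ->
  (1 - w) / (1 - w * y%:C%C) - psum (node_coef y) w N.+1 =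
  - ((1 - y%:C%C) * y%:C%C ^+ N * w ^+ N.+1 / (1 - w * y%:C%C)).
Proof.
move=> d0; elim: N => [|N IH].
  rewrite psumS /psum big_ord0 add0r !expr0 !mulr1 expr1 [(node_coef y 0)%:C%C]/=.
  by rewrite rmorph1; field.
rewrite psumS opprD addrA IH /node_coef rmorphN/= rmorphM/= rmorphB/= rmorphXn/= rmorph1.
by rewrite !exprS; field.
Qed.

Lemma normc_1B_ge (z : C) : 1 - normc z <= normc (1 - z).
Proof.
rewrite lerBlDr -[leLHS](@normc1 R) -{1}(subrK z 1); exact: ler_normcD.
Qed.

Lemma psum_node_coef_le (y : R) (w : C) N : `|y| <= 1 -> normc w <= 2^-1 ->
  normc ((1 - w) / (1 - w * y%:C%C) - psum (node_coef y) w N) <= 4 * normc w ^+ N.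
Proof.
move=> y1 w2; have w0 := normc_ge0 w.
have wy : normc (w * y%:C%C) <= 2^-1.
  by rewrite normcM normc_real -[leRHS]mulr1 ler_pM.
have d2 : 2^-1 <= normc (1 - w * y%:C%C).
  by have := normc_1B_ge (w * y%:C%C); lra.
have d0 : 1 - w * y%:C%C != 0.
  by apply/eqP => d0; move: d2; rewrite d0 normc0; lra.
have dV : (normc (1 - w * y%:C%C))^-1 <= 2.
  by rewrite invf_ple ?posrE//; apply: lt_le_trans d2; rewrite invr_gt0.
have dV0 : 0 <= (normc (1 - w * y%:C%C))^-1 by rewrite invr_ge0 normc_ge0.
case: N => [|N].
  rewrite /psum big_ord0 subr0 expr0 mulr1 normcM normcV.
  have : normc (1 - w) <= 2.
    apply: le_trans (ler_normcD _ _) _; rewrite normc_opp normc1; lra.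
  by move=> h; rewrite (_ : 4 = 2 * 2)//; [exact: ler_pM (normc_ge0 _) _ _ _|ring].
rewrite psum_node_coef// normc_opp !normcM normcV !normcX normc_real.
have y2 : normc (1 - y%:C%C) <= 2.
  apply: le_trans (ler_normcD _ _) _; rewrite normc_opp normc1 normc_real; lra.
have yN : `|y| ^+ N <= 1 by rewrite exprn_ile1.
have wN : 0 <= normc w ^+ N.+1 by rewrite exprn_ge0.
have H : normc (1 - y%:C%C) * `|y| ^+ N <= 2 * 1.
  by apply: ler_pM; rewrite ?normc_ge0 ?exprn_ge0.
rewrite mulrAC mulrC [leRHS]mulrC ler_wpM2l//.
rewrite (_ : 4 = 2 * 1 * 2); last by ring.
by apply: ler_pM => //; rewrite mulr_ge0 ?normc_ge0 ?exprn_ge0.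
Qed.

Lemma kernel_node (k x : R) (w : C) : 1 - w != 0 ->
  (1 + k%:C%C * w / (1 - w) * (x ^+ 2)%:C%C)^-1 =
  (1 - w) / (1 - w * (node k x)%:C%C).
Proof.
move=> w1; rewrite /node rmorphB/= rmorph1 rmorphM/=.
rewrite -[RHS]invf_div; congr (_ ^-1).
by field.
Qed.

Variables s k : R.
Hypothesis s0 : 0 < s.
Hypothesis k02 : 0 < k <= 2.
Local Notation wt := (weight s).

(** The integral of [node_coef (node k x) n] against the weight. *)
Definition moment_coef n :=
  if n is m.+1 then moment s k m.+1 - moment s k m else moment s k 0.

Lemma node_coef_le (y : R) n : `|y| <= 1 -> `|node_coef y n| <= 2.
Proof.
move=> y1; case: n => [|n] /=; first by rewrite normr1; lra.
rewrite normrN normrM -[2]mulr1 ler_pM//; last by rewrite normrX exprn_ile1.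
by move: y1; rewrite !ler_norml; lra.
Qed.

Lemma measurable_node_coef n A : measurable_fun A (fun x => node_coef (node k x) n).
Proof.
case: n => [|n]; first exact: measurable_cst.
apply: measurable_funN; apply: measurable_funM; last exact: measurable_node_pow.
by apply: measurable_funB; [exact: measurable_cst|exact: measurable_node].
Qed.

Lemma integrable_node_coef n :
  mu.-integrable D (EFin \o (fun x => wt x * node_coef (node k x) n)).
Proof.
apply: (integrable_weightM _ s0 _ 2); first exact: measurable_node_coef.
by move=> x Dx; apply: node_coef_le; exact: node_le1 k02 _ Dx.
Qed.

Lemma Rintegral_node_coef n :
  \int[mu]_(x in D) (wt x * node_coef (node k x) n) = moment_coef n.
Proof.
case: n => [|n] /=.
  by apply: eq_Rintegral => x _; rewrite expr0.
rewrite -[RHS]opprB (moment_diff _ _ s0 k02) -mulN1r -RintegralZl//.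
  by apply: eq_Rintegral => x _; rewrite /node; ring.
exact: integrable_moment_diff.
Qed.

(** Integrates a real truncated expansion; [rho] stands for the real parts, then
    the imaginary parts, of the powers of w. *)
Lemma Rintegral_kernel_le (rho : nat -> R) (h : R -> R) (B : R) N :
  measurable_fun D h -> (exists M, forall x, D x -> `|h x| <= M) ->
  (forall x, D x -> `|h x - \sum_(n < N) node_coef (node k x) n * rho n| <= B) ->
  `|\int[mu]_(x in D) (wt x * h x) - \sum_(n < N) moment_coef n * rho n| <=
    moment s k 0 * B.
Proof.
move=> mh [M hM] hB.
have ih : mu.-integrable D (EFin \o (fun x => wt x * h x)).
  exact: (integrable_weightM _ s0 _ M).
have [iS IS] :
    mu.-integrable D
      (EFin \o (fun x => wt x * \sum_(n < N) node_coef (node k x) n * rho n)) /\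
    \int[mu]_(x in D) (wt x * \sum_(n < N) node_coef (node k x) n * rho n) =
    \sum_(n < N) moment_coef n * rho n.
  elim: N {hB} => [|N [iS IS]].
    split.
      rewrite (_ : _ \o _ = cst 0%E); first exact: integrable0.
      by apply/funext => x /=; rewrite big_ord0 mulr0.
    by under eq_Rintegral do rewrite big_ord0 mulr0; rewrite Rintegral_cst// mul0r big_ord0.
  have iN : mu.-integrable D (EFin \o (fun x => wt x * node_coef (node k x) N * rho N)).
    rewrite (_ : _ \o _ = fun x =>
        ((EFin \o (fun x => (wt x * node_coef (node k x) N)%R)) x * (rho N)%:E)%E).
      by apply: integrableZr => //; exact: integrable_node_coef.
    by apply/funext => x /=; rewrite EFinM.
  have E x : wt x * \sum_(n < N.+1) node_coef (node k x) n * rho n =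
      wt x * (\sum_(n < N) node_coef (node k x) n * rho n) +
      wt x * node_coef (node k x) N * rho N.
    by rewrite big_ord_recr/= mulrDr mulrA.
  split.
    rewrite (_ : _ \o _ =
      (EFin \o (fun x => (wt x * \sum_(n < N) node_coef (node k x) n * rho n)%R)) \+
      (EFin \o (fun x => (wt x * node_coef (node k x) N * rho N)%R)))%E.
      exact: integrableD.
    by apply/funext => x /=; rewrite E EFinD.
  under eq_Rintegral do rewrite E.
  rewrite RintegralD// IS big_ord_recr/=; congr (_ + _).
  by rewrite RintegralZr//; [rewrite Rintegral_node_coef|exact: integrable_node_coef].
rewrite -IS -RintegralB//.
have iD : mu.-integrable D (EFin \o (fun x => wt x * h x -
    wt x * \sum_(n < N) node_coef (node k x) n * rho n)).
  rewrite (_ : _ \o _ = (EFin \o (fun x => (wt x * h x)%R)) \-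
     (EFin \o (fun x => (wt x * \sum_(n < N) node_coef (node k x) n * rho n)%R)))%E.
    exact: integrableB.
  by apply/funext => x /=; rewrite EFinB.
apply: le_trans (le_normr_Rintegral _ iD) _ => //.
rewrite /moment -RintegralZr//; last exact: integrable_moment.
apply: le_Rintegral => //.
- exact: integrable_norm.
- rewrite (_ : _ \o _ = fun x =>
        ((EFin \o (fun x => (wt x * node k x ^+ 0)%R)) x * B%:E)%E).
    by apply: integrableZr => //; exact: integrable_moment.
  by apply/funext => x /=; rewrite EFinM.
- move=> x Dx; have wx := wt_gt0 s _ Dx.
  by rewrite -mulrBr normrM (gtr0_norm wx) expr0 mulr1 ler_wpM2l ?(ltW wx)// hB.
Qed.

(** Termwise integration of [psum_node_coef_le]; its uniform error bound survives
    integration against the weight, up to the total mass. *)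
Lemma expansion_Fs :
  expansion (fun w : C => Fs s (k%:C%C * w / (1 - w)))
    (fun n => (Gamma s)^-1 * moment_coef n).
Proof.
apply: expansionZ; exists (8 * moment s k 0), 1; split => //.
  by rewrite mulr_ge0// ltW// moment0_gt0.
move=> w N; rewrite mul1r => w2.
set t := k%:C%C * w / (1 - w).
have w1 : 1 - w != 0.
  apply/eqP => w1; have := normc_1B_ge w; rewrite w1 normc0; lra.
have bnd m x : D x ->
    normc ((1 + t * (x ^+ 2)%:C%C)^-1 - psum (node_coef (node k x)) w m) <= 4 * normc w ^+ m.
  move=> Dx; rewrite kernel_node//; apply: psum_node_coef_le => //.
  exact: node_le1 k02 _ Dx.
have bnd0 x : D x -> normc (1 + t * (x ^+ 2)%:C%C)^-1 <= 4.
  by move=> /(bnd 0%N); rewrite /psum big_ord0 subr0 expr0 mulr1.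
apply: le_trans (normc_le_ReIm _) _; rewrite ReB ImB Re_psum Im_psum /Cintegral.
rewrite [complex.Re (Complex _ _)]/= [complex.Im (Complex _ _)]/=.
under eq_Rintegral do rewrite ReM_real.
under [X in _ + `|X - _|]eq_Rintegral do rewrite ImM_real.
have -> : 8 * moment s k 0 * normc w ^+ N =
  moment s k 0 * (4 * normc w ^+ N) + moment s k 0 * (4 * normc w ^+ N) by ring.
apply: lerD.
  apply: (Rintegral_kernel_le (fun n => complex.Re (w ^+ n))
    (fun x => complex.Re (1 + t * (x ^+ 2)%:C%C)^-1)).
  - exact: measurable_Re_kernel.
  - by exists 4 => x /bnd0; apply: le_trans; exact: Re_le_normc.
  - move=> x /(bnd N); apply: le_trans; rewrite -Re_psum -ReB; exact: Re_le_normc.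
apply: (Rintegral_kernel_le (fun n => complex.Im (w ^+ n))
  (fun x => complex.Im (1 + t * (x ^+ 2)%:C%C)^-1)).
- exact: measurable_Im_kernel.
- by exists 4 => x /bnd0; apply: le_trans; exact: Im_le_normc.
- move=> x /(bnd N); apply: le_trans; rewrite -Im_psum -ImB; exact: Im_le_normc.
Qed.

(** Normalizing by the value K at 0 leaves the series
    1 - sum_n gap n w^(n+1), whose inverse is the renewal series; the positive
    factor K^-r is harmless for the n-th roots. *)
Lemma taylor_coef_Fs_root (r : nat) (p : R) : (1 <= r)%N -> 0 < p ->
  (forall n, 0 <= gap s k n) ->
  limn_esup (fun n : nat =>
    ((complex.Re (taylor_coef (fun w => Fs s (k%:C%C * w / (1 - w)) ^- r) n) / p ^+ n)
      `^ (n%:R^-1))%:E) = (1 / p)%:E.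
Proof.
move=> r1 p0 g0; set u := renewal (gap s k).
have G0 := Gamma_gt0 s s0; have m0 := moment0_gt0 s k s0 k02.
pose K := moment s k 0 / Gamma s; have K0 : 0 < K by rewrite divr_gt0.
have u0 n : 0 <= u n by exact: renewal_ge0.
have u1 n : u n <= 1 by apply: renewal_le1 => // N; exact: sum_gap_le1.
have E1 : expansion (fun w : C => K^-1%:C%C * Fs s (k%:C%C * w / (1 - w)))
    (renewal_eq_coef (gap s k)).
  apply: eq_expansion (expansionZ _ _ K^-1 expansion_Fs) => n.
  case: n => [|n] /=; rewrite /K /gap; field; rewrite ?gt_eqF//.
have E2 := expansionV _ _ u 1 1 ler01 ltr01 _ (cauchy_prod_renewal _) E1.
have {}E2 := E2 ltac:(by move=> n; rewrite mul1r expr1n ger0_norm).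
have E3 : expansion (fun w : C => Fs s (k%:C%C * w / (1 - w)) ^- r)
    (fun n => K^-1 ^+ r * cauchy_pow u r n).
  have := expansionZ _ _ (K^-1 ^+ r) (expansionX _ _ r E2).
  congr (expansion _ _); apply/funext => w.
  rewrite rmorphXn/= -exprMn -exprVn; congr (_ ^+ _).
  have KC : (K^-1%:C%C : C) != 0.
    by rewrite -(rmorph0 (real_complex R)) (inj_eq (@complexI R)) invr_eq0 gt_eqF.
  by rewrite [(_ * Fs _ _)^-1]invfM mulVKf.
under eq_fun do rewrite (taylor_coef_expansion _ _ _ E3) [complex.Re _]/=.
apply: limn_esup_root => //.
  apply: slow_growthZ; first by rewrite exprn_ge0// invr_ge0 ltW.
  by apply: slow_growthX => //; exact: slow_growth_bounded.
apply: slow_decayZ; first by rewrite exprn_gt0// invr_gt0.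
apply: slow_decayX => //; apply: renewal_slow_decay => // e e01.
exact: gap_even_decay.
Qed.

End generating_function.

Lemma bcoefE {R : realType} (s : R) r n : bcoef s r n =
  complex.Re (taylor_coef (fun w => Fs s (1%:C%C * w / (1 - w)) ^- r) n).
Proof.
have E : (fun w => Hs s w ^- r) = (fun w => Fs s (1%:C%C * w / (1 - w)) ^- r).
  by apply/funext => w; rewrite /Hs rmorph1 mul1r.
by rewrite /bcoef E.
Qed.

Lemma ccoefE {R : realType} (s : R) r n : ccoef s r n =
  complex.Re (taylor_coef (fun w => Fs s (2%:C%C * w / (1 - w)) ^- r) n).
Proof.
have E : (fun w => As s w ^- r) = (fun w => Fs s (2%:C%C * w / (1 - w)) ^- r).
  by apply/funext => w; rewrite /As rmorph_nat.
by rewrite /ccoef E.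
Qed.

Theorem proposition4p8 (R : realType) (s : R) (r : nat)
    (hs : 0 < s) (hr : (1 <= r)%N) :
  limn_esup (fun n : nat => ((bcoef s r n / 2 ^+ n) `^ (n%:R^-1))%:E) = (1 / 2)%:E
  /\ (2 <= s ->
      limn_esup (fun n : nat => ((ccoef s r n / 3 ^+ n) `^ (n%:R^-1))%:E)
        = (1 / 3)%:E).
Proof.
split=> [|hs2].
  have k1 : 0 < (1 : R) <= 1 by rewrite ltr01 lexx.
  have k2 : 0 < (1 : R) <= 2 by rewrite ltr01 ler1n.
  under eq_fun do rewrite bcoefE.
  by apply: taylor_coef_Fs_root => // n; exact: gap_ge0_of_le1.
have k2 : 0 < (2 : R) <= 2 by rewrite ltr0n lexx.
under eq_fun do rewrite ccoefE.
apply: taylor_coef_Fs_root => // n.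
by have [on|en] := boolP (odd n); [exact: gap_odd_ge0|exact: gap_even_ge0].
Qed.
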